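(* Let $A$ be a coconnective dg-algebra and let $U\in\mathbf{D}(A,d)^{\leq 0}$ be a silting complex. Then there is a good silting complex $U'$ such that $U$ and $U'$ are equivalent.
   Context: $A$ is a dg-algebra over a commutative unital ring $k$; it is coconnective if $H^i(A)=0$ for all $i>0$. $\mathbf{D}(A,d)$ is the derived category of right dg-$A$-modules, and $\mathbf{D}(A,d)^{\leq 0}=\{X\mid H^i(X)=0\text{ for all }i>0\}$. For an object $U$, $\mathrm{add}(U)$ (resp. $\mathrm{Add}(U)$) is the class of direct summands of finite (resp. arbitrary) direct sums of copies of $U$, and $U^{\perp_{>0}}=\{X\mid\mathrm{Hom}_{\mathbf{D}(A,d)}(U,X[i])=0\text{ for all }i>0\}$. $\mathrm{Thick}(U)=\mathrm{thick}(\mathrm{Add}(U))$ is the smallest full triangulated subcategory containing $\mathrm{Add}(U)$ and closed under direct summands. $U$ is a silting complex if $\mathrm{Add}(U)\subseteq U^{\perp_{>0}}$ and $\mathrm{Thick}(U)=\mathrm{Thick}(A)$. For a class $\mathcal{C}$ of objects, $\mathrm{codim}_{\mathcal{C}}X\leq n$ means that there are triangles $X_i\to C_i\to X_{i+1}\to X_i[1]$, $0\leq i\leq n$, with $C_i\in\mathcal{C}$, $X_0=X$ and $X_{n+1}=0$; $\mathrm{codim}_{\mathcal{C}}X<\infty$ means this holds for some $n$. A silting complex $U$ is good if $\mathrm{codim}_{\mathrm{add}(U)}A<\infty$. Two silting complexes $U$, $U'$ are equivalent if $\mathrm{Add}(U)=\mathrm{Add}(U')$. *)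

(* Defs.v *)
From HB Require Import structures.
From mathcomp Require Import all_boot all_order all_algebra zify.
Set Implicit Arguments.
Unset Strict Implicit.
Unset Printing Implicit Defensive.
Import GRing.Theory.
Local Open Scope ring_scope.
Local Obligation Tactic := idtac.

(* Koszul sign: (-1)^n x *)
Definition ksgn (V : zmodType) (n : int) (x : V) : V :=
  if odd `|n|%N then - x else x.

Section KoszulSign.
Variables (R : pzRingType) (V : lmodType R) (n : int).

Lemma ksgn_linear : linear (@ksgn V n).
Proof.
rewrite /ksgn => a x y; case: (odd _) => //.
by rewrite opprD scalerN.
Qed.

HB.instance Definition _ :=
  GRing.isLinear.Build R V V *:%R (@ksgn V n) ksgn_linear.

End KoszulSign.

Lemma ksgn_add (V : zmodType) (n : int) (x y : V) :
  ksgn n (x + y) = ksgn n x + ksgn n y.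
Proof. by rewrite /ksgn; case: odd => //; rewrite opprD. Qed.

Lemma ksgnDK (V : zmodType) (m n : int) (x : V) :
  ksgn n (ksgn (m + n) x) = ksgn m x.
Proof.
have E : odd `|(m + n)%R|%N = odd `|m|%N (+) odd `|n|%N by lia.
by rewrite /ksgn E; do 2!case: odd; rewrite //= opprK.
Qed.

Lemma ksgnS (V : zmodType) (n : int) (x : V) : ksgn (n + 1) x = - ksgn n x.
Proof.
have E : odd `|(n + 1)%R|%N = ~~ odd `|n|%N by lia.
by rewrite /ksgn E; case: odd; rewrite //= opprK.
Qed.

(* A Z-grading V = (+)_i V^i, given by the projections V -> V^i;
   x is homogeneous of degree i iff gpr i x = x. *)
Record grading (V : zmodType) := Grading {
  gpr :> int -> {additive V -> V};
  gpr_orth : forall i j x, gpr i (gpr j x) = if i == j then gpr i x else 0;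
  gpr_sum : forall x, exists2 s : seq int, uniq s & x = \sum_(i <- s) gpr i x }.

Section GradingConstructions.

Lemma gpr_sumS (V : zmodType) (G : grading V) (x : V) (s t : seq int) :
  uniq s -> uniq t -> {subset s <= t} ->
  x = \sum_(i <- s) G i x -> x = \sum_(i <- t) G i x.
Proof.
move=> us ut st es.
rewrite (bigID (mem s)) /= [X in _ + X]big1 ?addr0; last first.
  move=> j js; rewrite es raddf_sum big_seq big1 // => i si.
  by rewrite gpr_orth; case: eqP => // ji; rewrite ji si in js.
rewrite -big_filter [LHS]es; apply: perm_big.
apply: uniq_perm; rewrite ?filter_uniq // => i.
by rewrite mem_filter /=; case si: (i \in s) => //=; rewrite st.
Qed.

(* V[n]^i = V^(i+n) *)
Program Definition regrade (V : zmodType) (n : int) (G : grading V) :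
  grading V := @Grading V (fun i => G (i + n)) _ _.
Next Obligation.
by move=> V n G i j x; rewrite gpr_orth (inj_eq (addIr n)).
Qed.
Next Obligation.
move=> V n G x; have [s us es] := gpr_sum G x.
exists [seq i - n | i <- s].
  by rewrite map_inj_uniq //; apply: addIr.
by rewrite big_map {1}es; apply: eq_bigr => i _; rewrite subrK.
Qed.

Variables (V W : zmodType).

Definition pair_fun (f : V -> V) (g : W -> W) (p : V * W) := (f p.1, g p.2).

Lemma pair_fun_additive (f : {additive V -> V}) (g : {additive W -> W}) :
  zmod_morphism (pair_fun f g).
Proof. by move=> p q; rewrite /pair_fun /= !raddfB. Qed.

HB.instance Definition _ (f : {additive V -> V}) (g : {additive W -> W}) :=
  GRing.isZmodMorphism.Build (V * W)%type (V * W)%type (pair_fun f g)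
    (pair_fun_additive f g).

(* (V (+) W)^i = V^i (+) W^i *)
Program Definition pair_gr (G : grading V) (H : grading W) :
  grading (V * W)%type :=
  @Grading (V * W)%type (fun i => pair_fun (G i) (H i)) _ _.
Next Obligation.
by move=> G H i j p; rewrite /= /pair_fun /= !gpr_orth; case: eqP.
Qed.
Next Obligation.
move=> G H [v w]; have [s us es] := gpr_sum G v; have [t ut et] := gpr_sum H w.
have un : uniq (undup (s ++ t)) by apply: undup_uniq.
exists (undup (s ++ t)) => //.
have sum1 : forall r : seq int, (\sum_(i <- r) pair_fun (G i) (H i) (v, w))
    = (\sum_(i <- r) G i v, \sum_(i <- r) H i w).
  elim=> [|i r IH]; first by rewrite !big_nil.
  by rewrite !big_cons IH.
rewrite sum1; congr (_, _).
- by apply: gpr_sumS es => // i si; rewrite mem_undup mem_cat si.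
- by apply: gpr_sumS et => // i si; rewrite mem_undup mem_cat si orbT.
Qed.

End GradingConstructions.

(* The k-algebra structure is the central ring morphism dga_scal. *)
Record dgAlg (k : comPzRingType) := DgAlg {
  dga_sort :> pzRingType;
  dga_scal : {rmorphism k -> dga_sort};
  dga_scalC : forall c a, dga_scal c * a = a * dga_scal c;
  dga_gr : grading dga_sort;
  dga_d : {additive dga_sort -> dga_sort};
  dga_grZ : forall i c a, dga_gr i (dga_scal c * a) = dga_scal c * dga_gr i a;
  dga_dZ : forall c a, dga_d (dga_scal c * a) = dga_scal c * dga_d a;
  dga_gr1 : dga_gr 0 1 = 1;
  dga_grM : forall i j a b, dga_gr i a = a -> dga_gr j b = b ->
    dga_gr (i + j) (a * b) = a * b;
  dga_d_deg : forall i a, dga_d (dga_gr i a) = dga_gr (i + 1) (dga_d a);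
  dga_dd : forall a, dga_d (dga_d a) = 0;
  dga_leibniz : forall i a b, dga_gr i a = a ->
    dga_d (a * b) = dga_d a * b + ksgn i (a * dga_d b) }.

(* A right A-module is a left module over the converse ring A^c, so that
   x.a is written (a : A^c) *: x.  The action of k is the one through
   dga_scal; k-linearity of the projections and of the differential follows
   from the axioms, since dga_scal c is a cocycle of degree 0. *)
Record dgMod (k : comPzRingType) (A : dgAlg k) := DgMod {
  dgm_sort :> lmodType A^c;
  dgm_gr : grading dgm_sort;
  dgm_d : {additive dgm_sort -> dgm_sort};
  dgm_grM : forall i j (x : dgm_sort) (a : A^c),
    dgm_gr i x = x -> dga_gr A j a = a -> dgm_gr (i + j) (a *: x) = a *: x;
  dgm_d_deg : forall i x, dgm_d (dgm_gr i x) = dgm_gr (i + 1) (dgm_d x);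
  dgm_dd : forall x, dgm_d (dgm_d x) = 0;
  dgm_leibniz : forall i (x : dgm_sort) (a : A^c), dgm_gr i x = x ->
    dgm_d (a *: x) = a *: dgm_d x + ksgn i ((dga_d A a : A^c) *: x) }.

Section DgModules.
Variables (k : comPzRingType) (A : dgAlg k).
Local Notation dgMod := (dgMod A).

Local Notation pr X i := (dgm_gr X i).
Local Notation d X := (dgm_d X).

Program Definition regular : dgMod :=
  @DgMod k A (A^c)^o (dga_gr A) (dga_d A) _ _ _ _.
Next Obligation. by move=> i j x a px pa; rewrite /= (dga_grM px pa). Qed.
Next Obligation. by move=> i x; rewrite dga_d_deg. Qed.
Next Obligation. by move=> x; rewrite dga_dd. Qed.
Next Obligation. by move=> i x a px; rewrite /= (dga_leibniz _ px). Qed.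

Definition cocycle (X : dgMod) (i : int) (x : X) := pr X i x = x /\ d X x = 0.

Definition cobound (X : dgMod) (i : int) (x : X) :=
  exists2 y : X, pr X (i - 1) y = y & d X y = x.

(* H^i(X) = 0 *)
Definition cohom0 (X : dgMod) (i : int) :=
  forall x : X, cocycle i x -> cobound i x.

Record dgHom (X Y : dgMod) := DgHom {
  dgh_fun :> {linear X -> Y};
  dgh_gr : forall i x, dgh_fun (pr X i x) = pr Y i (dgh_fun x);
  dgh_d : forall x, dgh_fun (d X x) = d Y (dgh_fun x) }.

Definition homotopic (X Y : dgMod) (f g : dgHom X Y) :=
  exists2 h : {linear X -> Y},
    forall i x, h (pr X i x) = pr Y (i - 1) (h x) &
    forall x, f x - g x = d Y (h x) + h (d X x).

(* f induces injections and surjections H^i(X) -> H^i(Y) for all i *)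
Definition qiso (X Y : dgMod) (f : dgHom X Y) := forall i : int,
  (forall x, cocycle i x -> cobound i (f x) -> cobound i x) /\
  (forall y, cocycle i y -> exists2 x, cocycle i x & cobound i (f x - y)).

Program Definition dgid (X : dgMod) : dgHom X X := @DgHom X X idfun _ _.
Next Obligation. by []. Qed.
Next Obligation. by []. Qed.

Program Definition dgzero (X Y : dgMod) : dgHom X Y := @DgHom X Y \0 _ _.
Next Obligation. by move=> *; rewrite /= raddf0. Qed.
Next Obligation. by move=> *; rewrite /= raddf0. Qed.

Program Definition dgcomp (X Y Z : dgMod) (g : dgHom Y Z) (f : dgHom X Y) :
  dgHom X Z := @DgHom X Z (g \o f) _ _.
Next Obligation. by move=> *; rewrite /= !dgh_gr. Qed.
Next Obligation. by move=> *; rewrite /= !dgh_d. Qed.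

Lemma cobound0 (X : dgMod) i : cobound i (0 : X).
Proof. by exists 0; rewrite raddf0. Qed.

Lemma coboundD (X : dgMod) i (x y : X) :
  cobound i x -> cobound i y -> cobound i (x + y).
Proof.
by case=> x' px <- [y' py <-]; exists (x' + y'); rewrite raddfD /= ?px ?py.
Qed.

Lemma dgh_cocycle (X Y : dgMod) (f : dgHom X Y) i x :
  cocycle i x -> cocycle i (f x).
Proof. by case=> px dx; split; rewrite -?dgh_gr -?dgh_d ?px ?dx ?raddf0. Qed.

Lemma dgh_cobound (X Y : dgMod) (f : dgHom X Y) i x :
  cobound i x -> cobound i (f x).
Proof. by case=> y py <-; exists (f y); rewrite -?dgh_gr -?dgh_d ?py. Qed.

Lemma qiso_id (X : dgMod) : qiso (dgid X).
Proof.
move=> i; split=> //= y cy; exists y => //.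
by rewrite subrr; apply: cobound0.
Qed.

Lemma qiso_comp (X Y Z : dgMod) (g : dgHom Y Z) (f : dgHom X Y) :
  qiso g -> qiso f -> qiso (dgcomp g f).
Proof.
move=> qg qf i; split=> [x cx bx | z cz] /=.
  apply: (qf i).1 => //; apply: (qg i).1 => //; exact: dgh_cocycle.
have [y cy by_] := (qg i).2 z cz; have [x cx bx] := (qf i).2 y cy.
exists x => //; rewrite -(subrK (g y) (g (f x))) -addrA -raddfB.
by apply: coboundD => //; apply: dgh_cobound.
Qed.

(** Shift: X[n]^i = X^(i+n), with differential (-1)^n d *)

Section Shift.
Variables (n : int) (X : dgMod).

Program Definition shift : dgMod :=
  @DgMod k A X (regrade n (dgm_gr X)) (@ksgn X n \o d X) _ _ _ _.
Next Obligation. by move=> i j x a px pa; rewrite /= addrAC dgm_grM. Qed.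
Next Obligation.
move=> i x; rewrite /= dgm_d_deg addrAC /ksgn.
by case: odd; rewrite ?raddfN.
Qed.
Next Obligation.
move=> x; rewrite /= /ksgn.
by case: odd; rewrite ?raddfN /= dgm_dd ?raddf0 ?oppr0.
Qed.
Next Obligation.
move=> i x a px; rewrite /= (dgm_leibniz a px) ksgn_add ksgnDK.
by rewrite linearZ.
Qed.

End Shift.

Program Definition shift_hom (n : int) (X Y : dgMod) (f : dgHom X Y) :
  dgHom (shift n X) (shift n Y) := @DgHom (shift n X) (shift n Y) f _ _.
Next Obligation. by move=> *; rewrite /= dgh_gr. Qed.
Next Obligation.
by move=> n X Y f x; rewrite /= /ksgn; case: odd; rewrite ?raddfN /= dgh_d.
Qed.

Lemma qiso_shift n (X Y : dgMod) (f : dgHom X Y) :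
  qiso f -> qiso (shift_hom n f).
Proof.
have cocS (Z : dgMod) i (z : Z) :
    @cocycle (shift n Z) i z <-> @cocycle Z (i + n) z.
  rewrite /cocycle /= /ksgn; case: odd => //; split=> -[-> /eqP dz]; split=> //.
  - by apply/eqP; rewrite -oppr_eq0.
  - by apply/eqP; rewrite oppr_eq0.
have cobS (Z : dgMod) i (z : Z) :
    @cobound (shift n Z) i z <-> @cobound Z (i + n) z.
  rewrite /cobound /= /ksgn -addrAC; case: odd => //.
  split=> -[y py dy]; exists (- y); rewrite ?raddfN ?py //=.
  by rewrite -dy opprK.
move=> qf i; split=> [x /cocS cx /cobS bx | y /cocS cy].
  by apply/cobS; apply: (qf _).1 => //.
have [x cx bx] := (qf _).2 y cy.
by exists x; [apply/cocS | apply/cobS].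
Qed.

(** Mapping cone: cone(f)^i = X^(i+1) (+) Y^i, d (x, y) = (- d x, f x + d y) *)

Section Cone.
Variables (X Y : dgMod) (f : dgHom X Y).
Let C : lmodType A^c := (X * Y)%type.

Definition cone_d_fun (p : C) : C := (- d X p.1, f p.1 + d Y p.2).

Lemma cone_d_additive : zmod_morphism cone_d_fun.
Proof.
move=> p q; rewrite /cone_d_fun /=; congr (_, _) => /=.
  by rewrite raddfB opprB opprK addrC.
by rewrite !raddfB /= addrACA opprD.
Qed.

HB.instance Definition _ :=
  GRing.isZmodMorphism.Build C C cone_d_fun cone_d_additive.

Program Definition cone : dgMod :=
  @DgMod k A C (pair_gr (regrade 1 (dgm_gr X)) (dgm_gr Y)) cone_d_fun _ _ _ _.
Next Obligation.
move=> i j [x y] a [px py] pa.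
by rewrite /= /pair_fun /= addrAC !dgm_grM.
Qed.
Next Obligation.
move=> i [x y]; rewrite /= /pair_fun /cone_d_fun /=.
by rewrite raddfN raddfD /= !dgm_d_deg dgh_gr.
Qed.
Next Obligation.
move=> [x y]; rewrite /= /cone_d_fun /= !raddfN raddfD /= !dgm_dd dgh_d addr0.
by rewrite addNr !oppr0.
Qed.
Next Obligation.
move=> i [x y] a [px py]; rewrite /= /cone_d_fun /=.
rewrite (dgm_leibniz a px) (dgm_leibniz a py) [f _]linearZ /= ksgnS.
rewrite opprD opprK -scalerN addrA -scalerDr.
by rewrite {3}/ksgn; case: ifP => oi; rewrite /ksgn oi.
Qed.

Definition cone_in_fun (y : Y) : C := (0, y).

Lemma cone_in_linear : linear cone_in_fun.
Proof. by move=> a x y; congr (_, _); rewrite /= scaler0 addr0. Qed.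

HB.instance Definition _ := GRing.isLinear.Build A^c Y C *:%R cone_in_fun
  cone_in_linear.

Program Definition cone_in : dgHom Y cone := @DgHom Y cone cone_in_fun _ _.
Next Obligation.
by move=> i y; rewrite /= /cone_in_fun /pair_fun /= raddf0.
Qed.
Next Obligation.
by move=> y; rewrite /= /cone_in_fun /cone_d_fun /= !raddf0 add0r.
Qed.

Program Definition cone_out : dgHom cone (shift 1 X) :=
  @DgHom cone (shift 1 X) (fst : C -> X) _ _.
Next Obligation. by []. Qed.
Next Obligation. by []. Qed.

End Cone.

(** Homotopy pullback of f : Z -> Y and t : W -> Y:
    P^i = Z^i (+) W^i (+) Y^(i-1), d (z, w, y) = (d z, d w, f z - t w - d y) *)

Section HomotopyPullback.
Variables (Z W Y : dgMod) (f : dgHom Z Y) (t : dgHom W Y).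
Let C : lmodType A^c := (Z * W * Y)%type.

Definition hpb_d_fun (p : C) : C :=
  (d Z p.1.1, d W p.1.2, f p.1.1 - t p.1.2 - d Y p.2).

Lemma hpb_d_additive : zmod_morphism hpb_d_fun.
Proof.
move=> p q; rewrite /hpb_d_fun /= !raddfB; congr (_, _) => /=.
by rewrite 2!opprD [RHS]addrACA [in RHS](addrACA (f p.1.1)).
Qed.

HB.instance Definition _ :=
  GRing.isZmodMorphism.Build C C hpb_d_fun hpb_d_additive.

Program Definition hpb : dgMod :=
  @DgMod k A C
    (pair_gr (pair_gr (dgm_gr Z) (dgm_gr W)) (regrade (- 1) (dgm_gr Y)))
    hpb_d_fun _ _ _ _.
Next Obligation.
move=> i j [[z w] y] a [pz pw py] pa.
by rewrite /= /pair_fun /= addrAC !dgm_grM.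
Qed.
Next Obligation.
move=> i [[z w] y]; rewrite /= /pair_fun /hpb_d_fun /=.
by rewrite !raddfB /= !dgm_d_deg !dgh_gr subrK addrK.
Qed.
Next Obligation.
move=> [[z w] y]; rewrite /= /hpb_d_fun /= !raddfB /= !dgm_dd !dgh_d.
by rewrite !oppr0 addr0 -opprD subrr.
Qed.
Next Obligation.
move=> i [[z w] y] a [pz pw py]; rewrite /= /hpb_d_fun /=.
rewrite (dgm_leibniz a pz) (dgm_leibniz a pw) (dgm_leibniz a py).
rewrite !linearZ /=.
have -> : ksgn (i - 1) y = - ksgn i y.
  by rewrite -[i in RHS](subrK 1) ksgnS opprK.
rewrite (scalerN _ (ksgn i y)) opprD opprK addrA -(scalerN a (d Y y)).
rewrite -!scalerDr.
by rewrite /ksgn; case: odd.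
Qed.

Program Definition hpb_l : dgHom hpb Z :=
  @DgHom hpb Z (fst \o fst : C -> Z) _ _.
Next Obligation. by []. Qed.
Next Obligation. by []. Qed.

Program Definition hpb_r : dgHom hpb W :=
  @DgHom hpb W (snd \o fst : C -> W) _ _.
Next Obligation. by []. Qed.
Next Obligation. by []. Qed.

Lemma qiso_hpb : qiso t -> qiso hpb_l.
Proof.
move=> qt i; split.
- move=> [[z w] y] [[pz pw py]] [dz dw dy] [z' pz' dz'] /=.
  rewrite /= in pz pw py dz dw dy pz' dz'.
  have [w' pw' dw'] : cobound i w.
    apply: (qt i).1 => //; exists (f z' - y).
      by rewrite raddfB /= -dgh_gr pz' py.
    rewrite raddfB /= -dgh_d dz'; move: dy.
    by move/subr0_eq <-; rewrite subKr.
  have [|w'' [pw'' dw''] [y'' py'' dy'']] :=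
      (qt (i - 1)).2 (f z' - y - t w').
    split; first by rewrite !raddfB /= -!dgh_gr pz' py pw'.
    rewrite !raddfB /= -!dgh_d dz' dw'.
    by rewrite addrAC.
  exists (z', w' + w'', - y'').
    by rewrite /= /pair_fun /= raddfD raddfN /= pz' pw' pw'' py''.
  rewrite /= /hpb_d_fun /= raddfD raddfN /= dz' dw' dw'' addr0; congr (_, _).
  rewrite opprK dy'' raddfD /= opprD.
  by rewrite (addrA (f z')) subrKA (addrAC (f z') (- y)) subKr.
- move=> z [pz dz].
  have [w [pw dw] [y py dy]] := (qt i).2 _ (dgh_cocycle f (conj pz dz)).
  exists (z, w, - y); last by rewrite /= subrr; apply: cobound0.
  split; rewrite /= /pair_fun /hpb_d_fun /=.
    by rewrite pz pw raddfN /= py.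
  by rewrite dz dw raddfN /= opprK dy subrKA subrr.
Qed.

End HomotopyPullback.

(** The derived category: morphisms are roofs X <-s- Z -f-> Y in the homotopy
    category with s a quasi-isomorphism; deq is equality of roofs (existence of
    a common refinement).  Composition uses the homotopy pullback. *)

Record dHom (X Y : dgMod) := DHom {
  apex : dgMod;
  dwit : dgHom apex X;
  dwit_qiso : qiso dwit;
  dleg : dgHom apex Y }.

Definition deq (X Y : dgMod) (u v : dHom X Y) :=
  exists (W : dgMod) (a : dgHom W (apex u)) (b : dgHom W (apex v)),
  [/\ qiso (dgcomp (dwit u) a),
      homotopic (dgcomp (dwit u) a) (dgcomp (dwit v) b) &
      homotopic (dgcomp (dleg u) a) (dgcomp (dleg v) b)].

Definition dloc (X Y : dgMod) (f : dgHom X Y) : dHom X Y :=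
  DHom (@qiso_id X) f.

Definition did (X : dgMod) : dHom X X := dloc (dgid X).

Definition dzero (X Y : dgMod) : dHom X Y := dloc (dgzero X Y).

Definition dcomp (X Y V : dgMod) (v : dHom Y V) (u : dHom X Y) : dHom X V :=
  DHom (qiso_comp (dwit_qiso u) (qiso_hpb (dleg u) (dwit_qiso v)))
       (dgcomp (dleg v) (hpb_r (dleg u) (dwit v))).

Definition dshift (n : int) (X Y : dgMod) (u : dHom X Y) :
  dHom (shift n X) (shift n Y) :=
  DHom (qiso_shift n (dwit_qiso u)) (shift_hom n (dleg u)).

Definition diso (X Y : dgMod) (u : dHom X Y) :=
  exists v : dHom Y X, deq (dcomp v u) (did X) /\ deq (dcomp u v) (did Y).

Definition is_zero (X : dgMod) := deq (did X) (dzero X X).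

Definition distinguished (X Y Z : dgMod)
    (u : dHom X Y) (v : dHom Y Z) (w : dHom Z (shift 1 X)) :=
  exists (X' Y' : dgMod) (f : dgHom X' Y')
    (a : dHom X X') (b : dHom Y Y') (c : dHom Z (cone f)),
  [/\ diso a, diso b & diso c] /\
  [/\ deq (dcomp b u) (dcomp (dloc f) a),
      deq (dcomp c v) (dcomp (dloc (cone_in f)) b) &
      deq (dcomp (dshift 1 a) w) (dcomp (dloc (cone_out f)) c)].

Definition triangle (X Y Z : dgMod) :=
  exists (u : dHom X Y) (v : dHom Y Z) (w : dHom Z (shift 1 X)),
  distinguished u v w.

(* Direct sums are coproducts in the derived category, given by their
   universal property. *)
Definition is_dsum (I : Type) (X : I -> dgMod) (S : dgMod) :=
  exists in_ : forall i, dHom (X i) S,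
  forall (Y : dgMod) (u : forall i, dHom (X i) Y),
  exists v : dHom S Y, (forall i, deq (dcomp v (in_ i)) (u i)) /\
    forall v' : dHom S Y, (forall i, deq (dcomp v' (in_ i)) (u i)) -> deq v' v.

Definition summand (X S : dgMod) :=
  exists Y : dgMod, is_dsum (fun b : bool => if b then X else Y) S.

Definition fin_add (U X : dgMod) :=
  exists (n : nat) (S : dgMod), is_dsum (fun _ : 'I_n => U) S /\ summand X S.

Definition Add (U X : dgMod) :=
  exists (I : Type) (S : dgMod), is_dsum (fun _ : I => U) S /\ summand X S.

Record thick_subcat (P : dgMod -> Prop) : Prop := {
  thick_zero : forall X, is_zero X -> P X;
  thick_iso : forall X Y (u : dHom X Y), diso u -> P X -> P Y;
  thick_shift : forall n X, P X -> P (shift n X);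
  thick_triangle : forall X Y Z, triangle X Y Z -> P X -> P Y -> P Z;
  thick_summand : forall X S, summand X S -> P S -> P X }.

Definition thick (C : dgMod -> Prop) (X : dgMod) :=
  forall P : dgMod -> Prop, thick_subcat P -> (forall Y, C Y -> P Y) -> P X.

Definition Thick (U : dgMod) := thick (Add U).

Definition perp_gt0 (U X : dgMod) :=
  forall i : int, 0 < i ->
  forall u : dHom U (shift i X), deq u (dzero U (shift i X)).

Definition silting (U : dgMod) :=
  (forall X, Add U X -> perp_gt0 U X) /\
  (forall X, Thick U X <-> Thick regular X).

Definition codim_le (C : dgMod -> Prop) (X : dgMod) (n : nat) :=
  exists Xs Cs : nat -> dgMod,
  [/\ Xs 0%N = X, is_zero (Xs n.+1) &
      forall i, (i <= n)%N -> C (Cs i) /\ triangle (Xs i) (Cs i) (Xs i.+1)].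

Definition good_silting (U : dgMod) :=
  silting U /\ exists n, codim_le (fin_add U) regular n.

Definition silting_equiv (U V : dgMod) := forall X, Add U X <-> Add V X.

Definition D_le0 (X : dgMod) := forall i : int, 0 < i -> cohom0 X i.

Definition coconnective := D_le0 regular.

End DgModules.

Arguments regular {k} A.
Arguments coconnective {k} A.

(* Main.v *)
(** Right dg-modules up to quasi-isomorphism are handled by a calculus of
    fractions on homotopy classes.  Put P = U^{perp_{>0}}.  Since U lies in
    thick(Add A), it is a direct summand of a homotopically projective module,
    so maps out of U form a set and every Y has an approximation C -> Y with C
    in Add(U) through which all maps U -> Y factor; if Y is in P then so is the
    cocone.  The objects X with X[m] in P for large m, and Hom(X, Z[i]) = 0 for
    all Z in P and large i, form a thick subcategory containing Add(U), hence A.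
    As Hom(A, C[i]) = H^i(C) = 0 for i > 0 and C in Add(U), shifting dimension
    along approximations yields Hom(A, Z[i]) = 0 for all Z in P and i > 0.
    Iterated approximation of A[m] in P then stops after m steps, and the
    octahedral axiom turns the resulting resolution into a coresolution of A of
    length m.  Its finitely many terms are direct summands of one coproduct U'
    of copies of U. *)

From HB Require Import structures.
Require Import Defs.
From mathcomp Require Import all_boot all_order all_algebra zify.
From mathcomp Require Import boolp.
From Stdlib Require Import Setoid Morphisms.

Set Implicit Arguments.
Unset Strict Implicit.
Unset Printing Implicit Defensive.
Import Order.TTheory GRing.Theory.
Local Open Scope ring_scope.
Local Obligation Tactic := idtac.

(** Approximations by Add(U) exist for every module; the difficulty is that their iteration must
    stop. A itself need not lie in P, and cocones stay in P only from there on, so A is first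
    replaced by A[m], which lies in P for large m because A is in Thick(U). The bound on i in Hom(X,
    Z[i]) = 0 is uniform in Z: shifting dimension replaces Z by ever new cocones, and a bound
    depending on Z might recede at each step. The uniform bound, sharpened to i > 0 for A, gives
    Hom(A[m], Z[i]) = 0 for i > m. Each cocone lowers this range by one, so the m-th cocone K has
    Hom(K, Z[i]) = 0 for all i > 0; its approximation splits and K lies in Add(U). The terms found
    this way lie in Add(U), in general not in add(U). Once they are absorbed together with U in one
    coproduct U' of copies of U, each of them is a summand of a single copy of U', while Add(U') =
    Add(U). *)

Inductive zexpr := ZVar of nat | ZZero | ZAdd of zexpr & zexpr | ZOpp of zexpr.

Fixpoint zeval (V : zmodType) (env : seq V) (e : zexpr) : V :=
  match e with
  | ZVar i => env`_i
  | ZZero => 0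
  | ZAdd e1 e2 => zeval env e1 + zeval env e2
  | ZOpp e1 => - zeval env e1
  end.

(** The flag [b] is the sign of the occurrences counted. Positive and negative ones are kept apart
    so that coefficients stay in [nat] and their comparison computes. *)
Fixpoint zcount (b : bool) (e : zexpr) (i : nat) : nat :=
  match e with
  | ZVar j => b && (i == j)
  | ZZero => 0
  | ZAdd e1 e2 => zcount b e1 i + zcount b e2 i
  | ZOpp e1 => zcount (~~ b) e1 i
  end.

Lemma zevalE (V : zmodType) (env : seq V) (e : zexpr) :
  zeval env e = \sum_(i < size env) (env`_i *+ zcount true e i
                                     - env`_i *+ zcount false e i).
Proof.
elim: e => [j||e1 IH1 e2 IH2|e IH] /=.
- case: (ltnP j (size env)) => [lt_j|ge_j]; last first.
    rewrite nth_default // big1 // => i _.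
    by rewrite ltn_eqF ?subrr // (leq_trans (ltn_ord i)).
  rewrite (bigD1 (Ordinal lt_j)) //= eqxx subr0 big1 ?addr0 // => i ne_ij.
  by rewrite -val_eqE /= in ne_ij; rewrite (negPf ne_ij) subrr.
- by rewrite big1 // => i _; rewrite subrr.
- rewrite IH1 IH2 -big_split; apply: eq_bigr => i _ /=.
  by rewrite !mulrnDr opprD addrACA.
- rewrite IH -sumrN; apply: eq_bigr => i _.
  by rewrite opprB.
Qed.

Lemma zeval_eq (V : zmodType) (env : seq V) (e1 e2 : zexpr) :
  all (fun i => zcount true e1 i + zcount false e2 i
                == zcount true e2 i + zcount false e1 i)%N
      (iota 0 (size env)) ->
  zeval env e1 = zeval env e2.
Proof.
move=> /allP E; rewrite !zevalE; apply: eq_bigr => i _.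
have /E/eqP Ei : val i \in iota 0 (size env) by rewrite mem_iota /=.
apply/eqP; rewrite -subr_eq0 opprB addrACA -opprD.
by rewrite -!mulrnDr Ei (addnC (zcount true e2 i)) subrr.
Qed.

(** The dummy [match constr:(Set)] runs the tactic [unify] inside a definition that returns a term;
    its failure backtracks to the rest of the list. *)
Ltac zindex x env :=
  lazymatch env with
  | ?y :: ?r =>
    match constr:(Set) with
    | _ => let _ := match constr:(Set) with _ => unify x y end in
           constr:(0%N)
    | _ => let n := zindex x r in constr:(S n)
    end
  end.

Ltac zenv t env :=
  lazymatch t with
  | (?a + ?b)%R => let e := zenv a env in zenv b e
  | (- ?a)%R => zenv a env
  | (0)%R => env
  | _ => match constr:(Set) with
         | _ => let n := zindex t env in env
         | _ => constr:(t :: env)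
         end
  end.

Ltac zquote t env :=
  lazymatch t with
  | (?a + ?b)%R => let x := zquote a env in let y := zquote b env in
                   constr:(ZAdd x y)
  | (- ?a)%R => let x := zquote a env in constr:(ZOpp x)
  | (0)%R => constr:(ZZero)
  | _ => let n := zindex t env in constr:(ZVar n)
  end.

(* Abelian group identities; atoms are compared by unification. *)
Ltac zmod :=
  lazymatch goal with
  | |- @eq ?T ?l ?r =>
    let env := zenv l (@nil T) in
    let env := zenv r env in
    let x := zquote l env in
    let y := zquote r env in
    refine (@zeval_eq _ env x y _); vm_compute; reflexivity
  end.

(** * Homotopies and quasi-isomorphisms *)

Lemma ksgnK (V : zmodType) (n : int) (x : V) : ksgn n (ksgn n x) = x.
Proof. by rewrite /ksgn; case: odd; rewrite //= opprK. Qed.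

Lemma ksgnD (V : zmodType) (m n : int) (x : V) :
  ksgn (m + n) x = ksgn m (ksgn n x).
Proof.
have E : odd `|(m + n)%R|%N = odd `|m|%N (+) odd `|n|%N by lia.
by rewrite /ksgn E; do 2!case: odd; rewrite //= opprK.
Qed.

Lemma raddf_ksgn (V W : zmodType) (f : {additive V -> W}) n x :
  f (ksgn n x) = ksgn n (f x).
Proof. by rewrite /ksgn; case: odd; rewrite ?raddfN. Qed.

Lemma pair_ext (S T : Type) (p q : S * T) :
  p.1 = q.1 -> p.2 = q.2 -> p = q.
Proof. by case: p q => [a b] [a' b'] /= -> ->. Qed.

Section Homotopy.
Variables (k : comPzRingType) (A : dgAlg k).
Local Notation dgMod := (dgMod A).
Local Notation pr X i := (dgm_gr X i).
Local Notation d X := (dgm_d X).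
Implicit Types X Y Z W T N : dgMod.

Definition dgHom_of X Y (f : X -> Y) (lf : linear f)
    (fgr : forall i x, f (pr X i x) = pr Y i (f x))
    (fd : forall x, f (d X x) = d Y (f x)) : dgHom X Y :=
  let g : {linear X -> Y} :=
    HB.pack_for {linear X -> Y} f (GRing.isLinear.Build _ _ _ _ f lf) in
  @DgHom k A X Y g fgr fd.

Lemma homotopicI X Y (f g : dgHom X Y) (h : X -> Y) :
  linear h -> (forall i x, h (pr X i x) = pr Y (i - 1) (h x)) ->
  (forall x, f x - g x = d Y (h x) + h (d X x)) -> homotopic f g.
Proof.
move=> lh hgr hd.
pose h' : {linear X -> Y} :=
  HB.pack_for {linear X -> Y} h (GRing.isLinear.Build _ _ _ _ h lh).
by exists h'.
Qed.

(** The zero homotopy. It lets pointwise equal morphisms be exchanged without comparing the proofs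
    stored in them. *)
Lemma eq_homotopic X Y (f g : dgHom X Y) : f =1 g -> homotopic f g.
Proof.
move=> fg; apply: (@homotopicI _ _ _ _ (fun=> 0)) => [a x y|i x|x].
- by rewrite scaler0 addr0.
- by rewrite raddf0.
- by rewrite fg subrr raddf0 addr0.
Qed.

Lemma homotopic_refl X Y (f : dgHom X Y) : homotopic f f.
Proof. exact: eq_homotopic. Qed.

Lemma homotopic_sym X Y (f g : dgHom X Y) : homotopic f g -> homotopic g f.
Proof.
case=> h hgr hd; apply: (@homotopicI _ _ _ _ (fun x => - h x)).
- by move=> a x y; rewrite linearP opprD scalerN.
- by move=> i x; rewrite hgr raddfN.
- by move=> x; rewrite raddfN -opprD -hd opprB.
Qed.

Lemma homotopic_trans X Y (f g e : dgHom X Y) :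
  homotopic f g -> homotopic g e -> homotopic f e.
Proof.
case=> h hgr hd [h' hgr' hd'].
apply: (@homotopicI _ _ _ _ (fun x => h x + h' x)).
- by move=> a x y; rewrite !linearP addrACA scalerDr.
- by move=> i x; rewrite hgr hgr' raddfD.
- by move=> x; rewrite raddfD addrACA -hd -hd'; zmod.
Qed.

Lemma eq_homotopicW X Y (f g f' g' : dgHom X Y) :
  homotopic f g -> f =1 f' -> g =1 g' -> homotopic f' g'.
Proof.
move=> fg ff gg; apply: homotopic_trans (homotopic_trans _ fg)
  (eq_homotopic gg).
by apply: eq_homotopic => x; rewrite ff.
Qed.

Lemma homotopic_compl X Y Z (g : dgHom Y Z) (f f' : dgHom X Y) :
  homotopic f f' -> homotopic (dgcomp g f) (dgcomp g f').
Proof.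
case=> h hgr hd; apply: (@homotopicI _ _ _ _ (fun x => g (h x))).
- by move=> a x y; rewrite !linearP.
- by move=> i x; rewrite hgr dgh_gr.
- by move=> x /=; rewrite -raddfB hd raddfD /= dgh_d.
Qed.

Lemma homotopic_compr X Y Z (g g' : dgHom Y Z) (f : dgHom X Y) :
  homotopic g g' -> homotopic (dgcomp g f) (dgcomp g' f).
Proof.
case=> h hgr hd; apply: (@homotopicI _ _ _ _ (fun x => h (f x))).
- by move=> a x y; rewrite !linearP.
- by move=> i x; rewrite -hgr dgh_gr.
- by move=> x /=; rewrite hd dgh_d.
Qed.

Lemma homotopic_shift n X Y (f g : dgHom X Y) :
  homotopic f g -> homotopic (shift_hom n f) (shift_hom n g).
Proof.
case=> h hgr hd.
(* The shifted differential carries the sign (-1)^n, so the homotopy has to carry it as well. *)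
apply: (@homotopicI (shift n X) (shift n Y) _ _ (fun x => ksgn n (h x))).
- by move=> a x y; rewrite !linearP.
- by move=> i x; rewrite /= hgr addrAC raddf_ksgn.
- by move=> x; rewrite /= hd raddf_ksgn ksgnK raddf_ksgn ksgnK.
Qed.

Lemma coboundN X i (x : X) : cobound i x -> cobound i (- x).
Proof. by case=> y py <-; exists (- y); rewrite raddfN ?py. Qed.

Lemma coboundB X i (x y : X) : cobound i x -> cobound i y -> cobound i (x - y).
Proof. by move=> bx by_; apply: coboundD => //; apply: coboundN. Qed.

Lemma cobound_cocycle X i (x : X) : cobound i x -> cocycle i x.
Proof.
case=> y py <-; split; last by rewrite dgm_dd.
by rewrite -{1}(subrK 1 i) -dgm_d_deg py.
Qed.

Lemma cocycleB X i (x y : X) : cocycle i x -> cocycle i y -> cocycle i (x - y).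
Proof. by move=> [px dx] [py dy]; split;
  rewrite raddfB /= ?px ?py ?dx ?dy ?subr0. Qed.

Lemma homotopic_cobound X Y (f g : dgHom X Y) i (x : X) :
  homotopic f g -> cocycle i x -> cobound i (f x - g x).
Proof.
case=> h hgr hd [px dx]; exists (h x); first by rewrite -hgr px.
by rewrite hd dx raddf0 addr0.
Qed.

Lemma qiso_homotopic X Y (f g : dgHom X Y) : homotopic f g -> qiso f -> qiso g.
Proof.
move=> fg qf i; split=> [x cx bgx|y cy].
  apply: (qf i).1 => //; rewrite -(subrK (g x) (f x)).
  by apply: coboundD => //; apply: homotopic_cobound.
have [x cx bx] := (qf i).2 y cy; exists x => //.
have -> : g x - y = (f x - y) - (f x - g x) by zmod.
by apply: coboundB => //; apply: homotopic_cobound.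
Qed.

Lemma qiso_cancell X Y Z (g : dgHom Y Z) (f : dgHom X Y) :
  qiso g -> qiso (dgcomp g f) -> qiso f.
Proof.
move=> qg qgf i; split=> [x cx bfx|y cy].
  by apply: (qgf i).1 => //=; apply: dgh_cobound.
have [x cx bx] := (qgf i).2 _ (dgh_cocycle g cy).
exists x => //; apply: (qg i).1; last by rewrite raddfB.
by apply: cocycleB => //; apply: dgh_cocycle.
Qed.

(** Injectivity on cohomology comes from [h g], surjectivity from [g f]. *)
Lemma qiso_2of6 X Y Z T (h : dgHom Z T) (g : dgHom Y Z) (f : dgHom X Y) :
  qiso (dgcomp g f) -> qiso (dgcomp h g) -> qiso g.
Proof.
move=> qgf qhg i; split=> [y cy bgy|z cz].
  by apply: (qhg i).1 => //=; apply: dgh_cobound.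
have [x cx bx] := (qgf i).2 z cz.
by exists (f x) => //; apply: dgh_cocycle.
Qed.

Lemma qiso_inverse X Y (f : dgHom X Y) (g : dgHom Y X) :
  homotopic (dgcomp g f) (dgid X) -> homotopic (dgcomp f g) (dgid Y) ->
  qiso f.
Proof.
move=> gf fg; apply: (@qiso_2of6 _ _ _ _ g f g).
  by apply: qiso_homotopic (homotopic_sym fg) _; apply: qiso_id.
by apply: qiso_homotopic (homotopic_sym gf) _; apply: qiso_id.
Qed.

(** The third coordinate of the homotopy pullback is the homotopy. *)
Lemma hpb_square X Y Z (f : dgHom X Y) (t : dgHom Z Y) :
  homotopic (dgcomp f (hpb_l f t)) (dgcomp t (hpb_r f t)).
Proof.
apply: (@homotopicI (hpb f t) _ _ _ (fun p => p.2)) => //= -[[x z] y] /=.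
by rewrite /hpb_d_fun /=; zmod.
Qed.

(** A homotopy of the outer square supplies the third coordinate, so the lift commutes strictly with
    both projections. *)
Lemma hpb_lift X Y Z W (f : dgHom X Y) (t : dgHom Z Y)
    (a : dgHom W X) (b : dgHom W Z) :
  homotopic (dgcomp f a) (dgcomp t b) ->
  exists c : dgHom W (hpb f t),
    hpb_l f t \o c =1 a /\ hpb_r f t \o c =1 b.
Proof.
case=> h hgr hd.
have lc : linear (fun w => (a w, b w, h w) : hpb f t).
  by move=> e x y; rewrite !linearP.
have cgr i w : (a (pr W i w), b (pr W i w), h (pr W i w))
               = pr (hpb f t) i (a w, b w, h w).
  by rewrite !dgh_gr hgr.
have cd w : (a (d W w), b (d W w), h (d W w)) = d (hpb f t) (a w, b w, h w).
  rewrite /= /hpb_d_fun /= !dgh_d; congr (_, _).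
  by have /= -> := hd w; zmod.
by exists (dgHom_of lc cgr cd).
Qed.

(* Maps equalised by a quasi-isomorphism [t] define a map to the homotopy
   pullback of [t] with itself, which the diagonal makes quasi-isomorphic to
   the source of [t]. *)
Lemma qiso_equalize X Y Z (t : dgHom Y Z) (f g : dgHom X Y) :
  qiso t -> homotopic (dgcomp t f) (dgcomp t g) ->
  exists W (s : dgHom W X), qiso s /\ homotopic (dgcomp f s) (dgcomp g s).
Proof.
move=> qt /hpb_lift[e [el er]].
have [//|dg [dl dr]] := @hpb_lift _ _ _ _ t t (dgid Y) (dgid Y).
  exact: homotopic_refl.
have qd : qiso dg.
  apply: qiso_cancell (qiso_hpb t qt) _.
  apply: (qiso_homotopic _ (@qiso_id _ A Y)); apply: eq_homotopic => y /=.
  by rewrite -[LHS]dl.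
exists (hpb e dg), (hpb_l e dg); split; first exact: qiso_hpb.
have square (p : dgHom (hpb t t) Y) (c : dgHom X Y) :
    p \o e =1 c -> p \o dg =1 idfun ->
    homotopic (dgcomp c (hpb_l e dg)) (hpb_r e dg).
  move=> pe pd; apply: homotopic_trans
    (homotopic_trans _ (homotopic_compl p (hpb_square e dg))) _.
    by apply: eq_homotopic => x /=; rewrite -pe.
  by apply: eq_homotopic => x /=; rewrite -[RHS]pd.
exact: homotopic_trans (square _ _ el dl) (homotopic_sym (square _ _ er dr)).
Qed.
End Homotopy.

(** * Calculus of fractions *)

Section Fractions.
Variables (k : comPzRingType) (A : dgAlg k).
Local Notation dgMod := (dgMod A).
Local Notation pr X i := (dgm_gr X i).
Local Notation d X := (dgm_d X).
Implicit Types X Y Z W T N : dgMod.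

Lemma deq_refl X Y (u : dHom X Y) : deq u u.
Proof.
exists (apex u), (dgid _), (dgid _); split; try exact: homotopic_refl.
by apply: (qiso_homotopic _ (dwit_qiso u)); apply: eq_homotopic.
Qed.

Lemma deq_sym X Y (u v : dHom X Y) : deq u v -> deq v u.
Proof.
case=> W [a [b [qa wab lab]]]; exists W, b, a; split; last 2 first.
- exact: homotopic_sym.
- exact: homotopic_sym.
- exact: qiso_homotopic wab qa.
Qed.

(** The two refinements are joined over the apex of [v]: [a2] is a quasi-isomorphism by
    cancellation, hence so is the projection of the pullback to the first refinement. *)
Lemma deq_trans X Y (u v w : dHom X Y) : deq u v -> deq v w -> deq u w.
Proof.
case=> W1 [a1 [b1 [qa1 w1 l1]]] [W2 [a2 [b2 [qa2 w2 l2]]]].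
have qa2' : qiso a2 := qiso_cancell (dwit_qiso v) qa2.
pose P := hpb b1 a2; have sq : homotopic _ _ := hpb_square b1 a2.
have H (T : dgMod) (p : dgHom (apex u) T) (q : dgHom (apex v) T)
    (r : dgHom (apex w) T) : homotopic (dgcomp p a1) (dgcomp q b1) ->
    homotopic (dgcomp q a2) (dgcomp r b2) ->
    homotopic (dgcomp p (dgcomp a1 (hpb_l b1 a2)))
              (dgcomp r (dgcomp b2 (hpb_r b1 a2))).
  move=> pq qr.
  have {}pq := homotopic_compr (hpb_l b1 a2) pq.
  have {}qr := homotopic_compr (hpb_r b1 a2) qr.
  exact: homotopic_trans pq (homotopic_trans (homotopic_compl q sq) qr).
exists P, (dgcomp a1 (hpb_l b1 a2)), (dgcomp b2 (hpb_r b1 a2)); split.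
- exact: qiso_comp qa1 (qiso_hpb b1 qa2').
- exact: H w1 w2.
- exact: H l1 l2.
Qed.

#[global] Instance deq_equivalence X Y : Equivalence (@deq k A X Y).
Proof.
by split; [exact: deq_refl | exact: deq_sym | exact: deq_trans].
Qed.

Lemma deq_roof X Y W (s s' : dgHom W X) (qs : qiso s) (qs' : qiso s')
    (f f' : dgHom W Y) :
  homotopic s s' -> homotopic f f' -> deq (DHom qs f) (DHom qs' f').
Proof. by move=> ss ff; exists W, (dgid _), (dgid _); split. Qed.

Lemma deq_refine X Y (u : dHom X Y) W (s : dgHom W X) (qs : qiso s)
    (p : dgHom W (apex u)) (f : dgHom W Y) :
  homotopic (dgcomp (dwit u) p) s -> homotopic (dgcomp (dleg u) p) f ->
  deq u (DHom qs f).
Proof.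
move=> us uf; exists W, p, (dgid _); split => //.
exact: qiso_homotopic (homotopic_sym us) qs.
Qed.

(** Composition does not depend on the Ore square chosen: two completions agree after [dwit v], so
    [qiso_equalize] makes them agree after a further refinement. Equations between roofs can then be
    read off from a convenient square. *)
Lemma dcompE X Y Z (u : dHom X Y) (v : dHom Y Z) W (p : dgHom W (apex u))
    (r : dgHom W (apex v)) (qp : qiso p) :
  homotopic (dgcomp (dleg u) p) (dgcomp (dwit v) r) ->
  deq (dcomp v u) (DHom (qiso_comp (dwit_qiso u) qp) (dgcomp (dleg v) r)).
Proof.
move=> sq; set l := hpb_l (dleg u) (dwit v); set r0 := hpb_r (dleg u) (dwit v).
have sq0 : homotopic (dgcomp (dleg u) l) (dgcomp (dwit v) r0) := hpb_square _ _.
have sq1 := hpb_square l p.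
set q1 := hpb_l l p in sq1; set q2 := hpb_r l p in sq1.
have [W' [s [qs rs]]] : exists W' (s : dgHom W' (hpb l p)),
    qiso s /\ homotopic (dgcomp (dgcomp r0 q1) s) (dgcomp (dgcomp r q2) s).
  apply: qiso_equalize (dwit_qiso v) _.
  have H1 := homotopic_compr q1 sq0; have H2 := homotopic_compr q2 sq.
  have H3 := homotopic_compl (dleg u) sq1.
  exact: homotopic_trans (homotopic_sym H1) (homotopic_trans H3 H2).
exists W', (dgcomp q1 s), (dgcomp q2 s); split.
- exact: qiso_comp (dwit_qiso (dcomp v u)) (qiso_comp (qiso_hpb l qp) qs).
- exact: eq_homotopicW (homotopic_compl (dwit u) (homotopic_compr s sq1)) _ _.
- exact: eq_homotopicW (homotopic_compl (dleg v) rs) _ _.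
Qed.

#[global] Instance dcomp_proper X Y Z :
  Proper (@deq k A Y Z ==> @deq k A X Y ==> @deq k A X Z) (@dcomp k A X Y Z).
Proof.
(* First [u] is changed, over a square built on a common refinement of [u] and [u']; then [v] in the
   same way. *)
move=> v v' ev u u' eu; apply: (@deq_trans _ _ _ (dcomp v u')).
  case: eu => W [a [b [qa wab lab]]].
  have qa' : qiso a := qiso_cancell (dwit_qiso u) qa.
  have qb : qiso b.
    by apply: (qiso_cancell (dwit_qiso u')); apply: qiso_homotopic wab qa.
  pose f := dgcomp (dleg u) a; have sq := hpb_square f (dwit v).
  have ql := qiso_hpb f (dwit_qiso v).
  set l := hpb_l f (dwit v) in sq ql; set r := hpb_r f (dwit v) in sq.
  have H1 := @dcompE _ _ _ u v _ (dgcomp a l) r (qiso_comp qa' ql) sq.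
  have H2 := @dcompE _ _ _ u' v _ (dgcomp b l) r (qiso_comp qb ql)
    (homotopic_trans (homotopic_sym (homotopic_compr l lab)) sq).
  apply: deq_trans H1 (deq_trans _ (deq_sym H2)).
  apply: deq_roof; last exact: homotopic_refl.
  exact: homotopic_compr l wab.
case: ev => W [a [b [qa wab lab]]].
pose t := dgcomp (dwit v) a; have sq := hpb_square (dleg u') t.
have ql := qiso_hpb (dleg u') qa.
set l := hpb_l _ _ in sq ql; set r := hpb_r _ _ in sq.
have H1 := @dcompE _ _ _ u' v _ l (dgcomp a r) ql sq.
have H2 := @dcompE _ _ _ u' v' _ l (dgcomp b r) ql
    (homotopic_trans sq (homotopic_compr r wab)).
apply: deq_trans H1 (deq_trans _ (deq_sym H2)).
apply: deq_roof; first exact: homotopic_refl.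
exact: homotopic_compr r lab.
Qed.

Lemma dcompA X Y Z T (u : dHom X Y) (v : dHom Y Z) (w : dHom Z T) :
  deq (dcomp w (dcomp v u)) (dcomp (dcomp w v) u).
Proof.
set l1 := hpb_l (dleg u) (dwit v); set r1 := hpb_r (dleg u) (dwit v).
have sq1 : homotopic (dgcomp (dleg u) l1) (dgcomp (dwit v) r1) := hpb_square _
  _.
pose f := dgcomp (dleg v) r1; have sq2 := hpb_square f (dwit w).
have ql2 := qiso_hpb f (dwit_qiso w).
set l2 := hpb_l f _ in sq2 ql2; set r2 := hpb_r f _ in sq2.
(* The pullback for [dcomp w (dcomp v u)] maps to that of [v] and [w], which gives a square
   computing the other bracketing on the same apex. *)
have [c [cl cr]] := @hpb_lift _ _ _ _ _ _ (dleg v) (dwit w) (dgcomp r1 l2) r2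
  sq2.
have ql1 : qiso l1 := qiso_hpb _ (dwit_qiso v).
have H := @dcompE _ _ _ u (dcomp w v) _ (dgcomp l1 l2) c (qiso_comp ql1 ql2).
apply: deq_sym; apply: deq_trans (H _) _.
  apply: homotopic_trans (homotopic_compr l2 sq1) _.
  by apply: eq_homotopic => x; apply: (congr1 (dwit v) (esym (cl x))).
apply: deq_roof; first exact: eq_homotopic.
by apply: eq_homotopic => x; apply: (congr1 (dleg w) (cr x)).
Qed.

Lemma dcomp_idr X Y (u : dHom X Y) : deq (dcomp u (did X)) u.
Proof.
have H := @dcompE _ _ _ (did X) u _ (dwit u) (dgid _) (dwit_qiso u).
apply: deq_trans (H _) _; first exact: eq_homotopic.
by apply: deq_sym; apply: (@deq_refine _ _ _ _ _ _ (dgid _));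
  apply: eq_homotopic.
Qed.

Lemma dcomp_idl X Y (u : dHom X Y) : deq (dcomp (did Y) u) u.
Proof.
have H := @dcompE _ _ _ u (did Y) _ (dgid _) (dleg u) (@qiso_id _ A _).
apply: deq_trans (H _) _; first exact: eq_homotopic.
by apply: deq_sym; apply: (@deq_refine _ _ _ _ _ _ (dgid _));
  apply: eq_homotopic.
Qed.

Lemma dloc_homotopic X Y (f g : dgHom X Y) :
  homotopic f g -> deq (dloc f) (dloc g).
Proof. by move=> fg; apply: deq_roof => //; apply: homotopic_refl. Qed.

Lemma dloc_comp X Y Z (g : dgHom Y Z) (f : dgHom X Y) :
  deq (dcomp (dloc g) (dloc f)) (dloc (dgcomp g f)).
Proof.
have H := @dcompE _ _ _ (dloc f) (dloc g) _ (dgid _) f (@qiso_id _ A _).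
apply: deq_trans (H _) _; first exact: eq_homotopic.
by apply: deq_roof; apply: eq_homotopic.
Qed.

(** With [dinvl] and [dinvr] this exhibits a roof as a fraction, and so reduces equations between
    roofs to equations between localised morphisms. *)
Lemma dcomp_wit X Y (u : dHom X Y) :
  deq (dcomp u (dloc (dwit u))) (dloc (dleg u)).
Proof.
have H := @dcompE _ _ _ (dloc (dwit u)) u _ (dgid _) (dgid _) (@qiso_id _ A _).
apply: deq_trans (H _) _; first exact: eq_homotopic.
by apply: deq_roof; apply: eq_homotopic.
Qed.

Definition dinv X Y (s : dgHom X Y) (qs : qiso s) : dHom Y X :=
  DHom qs (dgid X).

Lemma dinvl X Y (s : dgHom X Y) (qs : qiso s) :
  deq (dcomp (dinv qs) (dloc s)) (did X).
Proof.
have H := @dcompE _ _ _ (dloc s) (dinv qs) _ (dgid _) (dgid _) (@qiso_id _ A _).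
apply: deq_trans (H _) _; first exact: eq_homotopic.
by apply: deq_roof; apply: eq_homotopic.
Qed.

Lemma dinvr X Y (s : dgHom X Y) (qs : qiso s) :
  deq (dcomp (dloc s) (dinv qs)) (did Y).
Proof.
have H := @dcompE _ _ _ (dinv qs) (dloc s) _ (dgid _) (dgid _) (@qiso_id _ A _).
apply: deq_trans (H _) _; first exact: eq_homotopic.
by apply: deq_sym; apply: (@deq_refine _ _ (did Y) _ _ _ s);
  apply: eq_homotopic.
Qed.

Lemma dcomp0 X Y Z (v : dHom Y Z) : deq (dcomp v (dzero X Y)) (dzero X Z).
Proof.
have H := @dcompE _ _ _ (dzero X Y) v _ (dgid _) (dgzero _ _) (@qiso_id _ A _).
apply: deq_trans (H _) _.
  by apply: eq_homotopic => x /=; rewrite raddf0.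
by apply: deq_roof; apply: eq_homotopic => x //=; rewrite raddf0.
Qed.

Lemma dcomp0l X Y Z (u : dHom X Y) : deq (dcomp (dzero Y Z) u) (dzero X Z).
Proof.
have H := @dcompE _ _ _ u (dzero Y Z) _ (dgid _) (dleg u) (@qiso_id _ A _).
apply: deq_trans (H _) _; first exact: eq_homotopic.
by apply: deq_sym; apply: (@deq_refine _ _ (dzero X Z) _ _ _ (dwit u));
  apply: eq_homotopic.
Qed.

Lemma dloc_eqP X Y (f g : dgHom X Y) : deq (dloc f) (dloc g) <->
  exists W (s : dgHom W X), qiso s /\ homotopic (dgcomp f s) (dgcomp g s).
Proof.
split=> [[W [a [b /= [qa wab lab]]]] | [W [s [qs fg]]]].
  exists W, a; split.
    by apply: qiso_homotopic qa; apply: eq_homotopic.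
  apply: homotopic_trans lab _; apply: (homotopic_compl g).
  by apply: homotopic_trans (homotopic_trans _ (homotopic_sym wab)) _;
    apply: eq_homotopic.
exists W, s, s; split=> //; exact: homotopic_refl.
Qed.

Lemma deq0P X Y (u : dHom X Y) : deq u (dzero X Y) <->
  exists W (t : dgHom W (apex u)),
    qiso t /\ homotopic (dgcomp (dleg u) t) (dgzero W Y).
Proof.
split=> [[W [a [b /= [qa _ lab]]]] | [W [t [qt ut0]]]].
  by exists W, a; split=> //; apply: qiso_cancell (dwit_qiso u) qa.
exists W, t, (dgcomp (dwit u) t); split.
- exact: qiso_comp (dwit_qiso u) qt.
- exact: eq_homotopic.
- by apply: homotopic_trans ut0 _; apply: eq_homotopic.
Qed.
End Fractions.
#[global] Hint Resolve deq_refl homotopic_refl : core.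

(** * Isomorphisms of the derived category as pairs of quasi-isomorphisms *)

Section QuasiIsomorphism.
Variables (k : comPzRingType) (A : dgAlg k).
Local Notation dgMod := (dgMod A).
Local Notation pr X i := (dgm_gr X i).
Local Notation d X := (dgm_d X).
Implicit Types X Y Z W T N : dgMod.

(** Isomorphism in the derived category without mention of an inverse, hence easy to build from
    explicit maps; [qeqP] identifies the two notions. *)
Definition qeq X Y :=
  exists W (s : dgHom W X) (t : dgHom W Y), qiso s /\ qiso t.

Lemma qeq_refl X : qeq X X.
Proof. by exists X, (dgid X), (dgid X); split; apply: qiso_id. Qed.

Lemma qeq_sym X Y : qeq X Y -> qeq Y X.
Proof. by case=> W [s [t [qs qt]]]; exists W, t, s. Qed.

Lemma qeq_trans X Y Z : qeq X Y -> qeq Y Z -> qeq X Z.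
Proof.
case=> W [s [t [qs qt]]] [W' [s' [t' [qs' qt']]]].
have ql := qiso_hpb t qs'; have sq := hpb_square t s'.
have qr : qiso (hpb_r t s').
  by apply: (qiso_cancell qs'); apply: qiso_homotopic sq _; apply: qiso_comp.
exists (hpb t s'), (dgcomp s (hpb_l t s')), (dgcomp t' (hpb_r t s')).
by split; apply: qiso_comp.
Qed.

Lemma qiso_qeq X Y (f : dgHom X Y) : qiso f -> qeq X Y.
Proof. by move=> qf; exists X, (dgid X), f; split=> //; apply: qiso_id. Qed.

Lemma qiso_diso X Y (f : dgHom X Y) : qiso f -> diso (dloc f).
Proof. by move=> qf; exists (dinv qf); split;
  [apply: dinvl | apply: dinvr]. Qed.

Lemma diso_comp X Y Z (u : dHom X Y) (v : dHom Y Z) :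
  diso u -> diso v -> diso (dcomp v u).
Proof.
case=> u' [uu' u'u] [v' [vv' v'v]]; exists (dcomp u' v'); split.
  by rewrite dcompA -(dcompA v v' u') vv' dcomp_idr uu'.
by rewrite dcompA -(dcompA u' u v) u'u dcomp_idr v'v.
Qed.

Lemma diso_proper X Y (u v : dHom X Y) : deq u v -> diso u -> diso v.
Proof. by move=> uv [w [uw wu]]; exists w; rewrite -!uv. Qed.

(** In place of a cohomology functor, the two identities for the inverse [v] are applied to
    cocycles: [u v = 1] makes the leg surjective on cohomology, [v u = 1] makes it injective. *)
Lemma diso_qiso X Y (u : dHom X Y) : diso u -> qiso (dleg u).
Proof.
have did_witness Z T (v : dHom Z Z) : deq v (did Z) ->
    exists P (a : dgHom P (apex v)), qiso a /\ qiso (dgcomp (dleg v) a).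
  case=> P [a [b [qva w l]]]; exists P, a; split.
    exact: qiso_cancell (dwit_qiso v) qva.
  apply: qiso_homotopic (homotopic_sym l) _.
  by apply: qiso_homotopic w qva.
case: u => W s qs g [[V t qt h] [/did_witness vu /did_witness uv]] /=.
have {vu} [P [a [/= qa qha]]] := vu Y; have {uv} [Q [b [/= qb qgb]]] := uv X.
have sq : homotopic _ _ := hpb_square g t.
set l := hpb_l g t in sq; set r := hpb_r g t in qha sq.
have ql : qiso l := qiso_hpb g qt.
move=> i; split=> [w cw bgw|y cy]; last first.
  have [x cx bx] := (qgb i).2 y cy.
  by exists (hpb_r h s (b x)) => //; do 2!apply: dgh_cocycle.
have [p cp bp] := (qiso_comp ql qa i).2 w cw.
rewrite -(subKr (l (a p)) w); apply: coboundB; last by [].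
apply: (dgh_cobound (dgcomp l a)); apply: (qha i).1 => //.
apply: (dgh_cobound h (x := r (a p))); apply: (qt i).1.
  exact: (dgh_cocycle (dgcomp r a)).
have ca : cocycle i (a p) by apply: dgh_cocycle.
rewrite -(subKr (g (l (a p))) (t _)); apply: coboundB.
  rewrite -(subrK (g w) (g (l (a p)))); apply: coboundD => //.
  by rewrite -raddfB; apply: dgh_cobound.
exact: (homotopic_cobound sq ca).
Qed.
End QuasiIsomorphism.

(** * Products and left fractions *)

Section Products.
Variables (k : comPzRingType) (A : dgAlg k).
Local Notation dgMod := (dgMod A).
Local Notation pr X i := (dgm_gr X i).
Local Notation d X := (dgm_d X).
Implicit Types X Y Z W T N : dgMod.

Lemma qeqP X Y : qeq X Y <-> exists u : dHom X Y, diso u.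
Proof.
split=> [[W [s [t [qs qt]]]] | [u du]].
  exists (dcomp (dloc t) (dinv qs)); apply: diso_comp (qiso_diso qt).
  by exists (dloc s); split; [apply: dinvr | apply: dinvl].
by exists (apex u), (dwit u), (dleg u); split;
  [apply: dwit_qiso | apply: diso_qiso].
Qed.

Lemma diso_inv X Y (u : dHom X Y) : diso u -> exists v : dHom Y X,
  [/\ diso v, deq (dcomp v u) (did X) & deq (dcomp u v) (did Y)].
Proof. by case=> v [vu uv]; exists v; split=> //; exists u. Qed.

(** Exactness of Hom is later used mainly through vanishing, so that roofs never have to be
    added. *)
Definition hz X Y := forall u : dHom X Y, deq u (dzero X Y).

Lemma hz_qeq X X' Y Y' : qeq X X' -> qeq Y Y' -> hz X Y -> hz X' Y'.
Proof.
move=> /qeqP[a /diso_inv[a' [_ _ aa']]] /qeqP[b /diso_inv[b' [_ _ bb']]] z u.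
have -> : deq u (dcomp b (dcomp (dcomp b' (dcomp u a)) a')).
  by rewrite !dcompA bb' dcomp_idl -dcompA aa' dcomp_idr.
by rewrite (z (dcomp b' (dcomp u a))) dcomp0l dcomp0.
Qed.

Program Definition prodm X Y : dgMod :=
  @DgMod k A (X * Y)%type (pair_gr (dgm_gr X) (dgm_gr Y))
    (pair_fun (d X) (d Y)) _ _ _ _.
Next Obligation.
by move=> X Y i j [x y] a [px py] pa; rewrite /= /pair_fun /= !dgm_grM.
Qed.
Next Obligation. by move=> X Y i [x y]; rewrite /= /pair_fun /= !dgm_d_deg. Qed.
Next Obligation. by move=> X Y [x y]; rewrite /= /pair_fun /= !dgm_dd. Qed.
Next Obligation.
move=> X Y i [x y] a [px py]; rewrite /= /pair_fun /=.
by rewrite (dgm_leibniz a px) (dgm_leibniz a py) /ksgn; case: odd.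
Qed.

Program Definition prod_fst X Y : dgHom (prodm X Y) X :=
  @DgHom k A (prodm X Y) X (fst : (X * Y)%type -> X) _ _.
Next Obligation. by []. Qed.
Next Obligation. by []. Qed.

Program Definition prod_snd X Y : dgHom (prodm X Y) Y :=
  @DgHom k A (prodm X Y) Y (snd : (X * Y)%type -> Y) _ _.
Next Obligation. by []. Qed.
Next Obligation. by []. Qed.

Section Pairing.
Variables (X Y Z : dgMod).

Lemma prod_pair_lin (f : dgHom Z X) (g : dgHom Z Y) :
  linear (fun z => (f z, g z) : prodm X Y).
Proof. by move=> a x y; rewrite !linearP. Qed.

Lemma prod_pair_gr (f : dgHom Z X) (g : dgHom Z Y) i z :
  (f (pr Z i z), g (pr Z i z)) = pr (prodm X Y) i (f z, g z).
Proof. by rewrite !dgh_gr. Qed.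

Lemma prod_pair_d (f : dgHom Z X) (g : dgHom Z Y) z :
  (f (d Z z), g (d Z z)) = d (prodm X Y) (f z, g z).
Proof. by rewrite !dgh_d. Qed.

Definition prod_pair f g : dgHom Z (prodm X Y) :=
  dgHom_of (@prod_pair_lin f g) (@prod_pair_gr f g) (@prod_pair_d f g).

End Pairing.

Definition prod_in1 X Y : dgHom X (prodm X Y) :=
  prod_pair (dgid X) (dgzero X Y).
Definition prod_in2 X Y : dgHom Y (prodm X Y) :=
  prod_pair (dgzero Y X) (dgid Y).
Definition prod_map X X' Y Y' (f : dgHom X X') (g : dgHom Y Y') :=
  prod_pair (dgcomp f (prod_fst X Y)) (dgcomp g (prod_snd X Y)).

Lemma prod_cocycle X Y i (x : X) (y : Y) :
  @cocycle k A (prodm X Y) i (x, y) <-> cocycle i x /\ cocycle i y.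
Proof. by split=> [[[px py] [dx dy]] | [[px dx] [py dy]]]; split;
  rewrite //= /pair_fun /= ?px ?py ?dx ?dy. Qed.

Lemma prod_cobound X Y i (x : X) (y : Y) :
  @cobound k A (prodm X Y) i (x, y) <-> cobound i x /\ cobound i y.
Proof.
split=> [[[x' y'] [px py] [dx dy]] | [[x' px dx] [y' py dy]]].
  by split; [exists x' | exists y'].
by exists (x', y'); rewrite /= /pair_fun /= ?px ?py ?dx ?dy.
Qed.

Lemma qiso_prod X X' Y Y' (f : dgHom X X') (g : dgHom Y Y') :
  qiso f -> qiso g -> qiso (prod_map f g).
Proof.
move=> qf qg i; split=> [[x y] /prod_cocycle[cx cy] /= /prod_cobound[bx by_]|].
  by apply/prod_cobound; split; [apply: (qf i).1 | apply: (qg i).1].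
move=> [x y] /prod_cocycle[/((qf i).2) [x' cx bx] /((qg i).2) [y' cy by_]].
by exists (x', y'); [apply/prod_cocycle | apply/prod_cobound].
Qed.

Lemma qeq_prod X X' Y Y' :
  qeq X X' -> qeq Y Y' -> qeq (prodm X Y) (prodm X' Y').
Proof.
move=> [W [s [t [qs qt]]]] [V [s' [t' [qs' qt']]]].
by exists (prodm W V), (prod_map s s'), (prod_map t t'); split;
  apply: qiso_prod.
Qed.

(* [P] is the homotopy pushout of [s] and [f]. *)
Lemma left_ore X Y W (s : dgHom W X) (f : dgHom W Y) : qiso s ->
  exists P (t : dgHom Y P) (g : dgHom X P),
    qiso t /\ homotopic (dgcomp t f) (dgcomp g s).
Proof.
move=> qs.
have ln : linear (fun w => (s w, - f w) : prodm X Y).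
  by move=> a x y; rewrite !linearP; congr (_, _); rewrite /= scalerN; zmod.
have ngr i w : (s (pr W i w), - f (pr W i w)) = pr (prodm X Y) i (s w, - f w).
  by rewrite !dgh_gr -raddfN.
have nd w : (s (d W w), - f (d W w)) = d (prodm X Y) (s w, - f w).
  by rewrite !dgh_d -raddfN.
pose phi := dgHom_of ln ngr nd.
pose t := dgcomp (cone_in phi) (prod_in2 X Y).
pose g := dgcomp (cone_in phi) (prod_in1 X Y).
exists (cone phi), t, g; split; last first.
  apply: homotopic_sym.
  apply: (@homotopicI _ _ W (cone phi) _ _ (fun w => (w, 0))).
  - by move=> a x y; congr (_, _); rewrite /= scaler0 addr0.
  - move=> i w; rewrite /= /pair_fun /= subrK; congr (_, _).
    by apply: pair_ext; rewrite /= !raddf0.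
  - move=> w; apply: pair_ext; first by rewrite /=; zmod.
    by apply: pair_ext; rewrite /= /pair_fun /= !raddf0; zmod.
(* In both halves the W-coordinate is a cocycle whose image under [s] bounds, so it bounds in W and
   can be removed. For surjectivity the remaining X-coordinate is then moved to Y through a
   preimage, up to boundary, under [s]. *)
move=> i; split=> [y cy [[w [x y']] /= [pw px py'] [dw dx dy]]|].
  rewrite /= in px py' dw dx dy.
  have bsw : cobound (i - 1 + 1) (s w).
    exists (- x); first by rewrite addrK raddfN px.
    by rewrite raddfN; apply/eqP; rewrite eq_sym -addr_eq0 dx.
  have [w' pw' dw'] : cobound (i - 1 + 1) w.
    apply: (qs _).1 => //; split=> //.
    by apply/eqP; rewrite -oppr_eq0 dw.
  rewrite addrK in pw'.
  exists (y' - f w'); first by rewrite raddfB /= -dgh_gr pw' py'.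
  by rewrite raddfB /= -dgh_d dw' -dy addrC.
move=> [w [x y]] [[pw px py] [dw dx dy]].
rewrite /= in pw px py dw dx dy.
have dw0 : d W w = 0 by apply/eqP; rewrite -oppr_eq0 dw.
have [w' pw' dw'] : cobound (i + 1) w.
  apply: (qs _).1; first by split.
  exists (- x); first by rewrite addrK raddfN px.
  by rewrite raddfN; apply/eqP; rewrite eq_sym -addr_eq0 dx.
rewrite addrK in pw'.
have [|w1 [pw1 dw1] [x2 px2 dx2]] := (qs i).2 (x + s w').
  split; first by rewrite raddfD /= -dgh_gr pw' px.
  by rewrite raddfD /= -dgh_d dw' addrC.
exists (y - f w' + f w1).
  split; first by rewrite !raddfD raddfN /= -!dgh_gr pw' pw1 py.
  by rewrite !raddfD raddfN /= -!dgh_d dw' dw1 raddf0 addr0 addrC.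
exists (w' - w1, (x2, 0)).
  rewrite /= /pair_fun /= raddfB /= subrK pw' pw1 px2.
  by rewrite raddf0.
rewrite /= /cone_d_fun /cone_in_fun /= !raddfB /= dw' dw1.
congr (_, _); first by rewrite /=; zmod.
congr (_, _); rewrite /= ?dx2 ?raddf0; zmod.
Qed.
End Products.

(** * Mapping cones *)

Section ConeMaps.
Variables (k : comPzRingType) (A : dgAlg k).
Local Notation dgMod := (dgMod A).
Local Notation pr X i := (dgm_gr X i).
Local Notation d X := (dgm_d X).
Implicit Types X Y Z W T N : dgMod.

(** The left Ore condition turns a right fraction into a left one. This makes a morphism strict
    without changing its source. *)
Lemma left_roof X Y (u : dHom X Y) :
  exists Y' (t : dgHom Y Y') (g : dgHom X Y'),
    qiso t /\ deq (dcomp (dloc t) u) (dloc g).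
Proof.
have [P [t [g [qt tg]]]] := left_ore (dleg u) (dwit_qiso u).
exists P, t, g; split=> //.
rewrite -[u in dcomp _ u]dcomp_idr -(dinvr (dwit_qiso u)) (dcompA _ _ u)
  dcomp_wit.
rewrite dcompA dloc_comp (dloc_homotopic tg) -dloc_comp -dcompA dinvr.
by rewrite dcomp_idr.
Qed.

Section ConeMap.
Variables (X Y X' Y' : dgMod) (f : dgHom X Y) (f' : dgHom X' Y').
Variables (a : dgHom X X') (b : dgHom Y Y').

(** The homotopy enters as (x, y) -> (a x, b y + h x). The conclusion hides it and keeps exactly
    what the five lemma for cones asks. *)
Lemma cone_map : homotopic (dgcomp b f) (dgcomp f' a) ->
  exists g : dgHom (cone f) (cone f'),
    (forall y, g (0, y) = (0, b y)) /\ forall p, (g p).1 = a p.1.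
Proof.
case=> h hgr hd.
have gl : linear (fun p : cone f => (a p.1, b p.2 + h p.1) : cone f').
  move=> c p q; apply: pair_ext; rewrite /= !linearP //=.
  by rewrite scalerDr; zmod.
have ggr i p : (a (pr (cone f) i p).1,
                b (pr (cone f) i p).2 + h (pr (cone f) i p).1)
               = pr (cone f') i (a p.1, b p.2 + h p.1).
  apply: pair_ext; rewrite /= ?raddfD /= !dgh_gr ?hgr //.
  by rewrite addrK.
have gd p : (a (d (cone f) p).1, b (d (cone f) p).2 + h (d (cone f) p).1)
               = d (cone f') (a p.1, b p.2 + h p.1).
  apply: pair_ext; rewrite /= ?raddfD ?raddfN /= !dgh_d //.
  have /= E := hd p.1.
  have -> : b (f p.1) = f' (a p.1) + (d Y' (h p.1) + h (d X p.1)).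
    by rewrite -E; zmod.
  zmod.
exists (dgHom_of gl ggr gd); split=> [y|p] //=.
by apply: pair_ext; rewrite /= !raddf0 ?addr0.
Qed.

(** The five lemma for the cohomology sequences of the two cones, done by elements. *)
Lemma qiso_cone (g : dgHom (cone f) (cone f')) :
  qiso a -> qiso b ->
  (forall y, g (0, y) = (0, b y)) -> (forall p, (g p).1 = a p.1) -> qiso g.
Proof.
move=> qa qb g2 g1 i.
(* Exactness at the cone: if the first coordinate of a cocycle bounds, the cocycle is cohomologous
   to one coming from the target of the map. *)
have cone_cob (W V : dgMod) (e : dgHom W V) (w : W) (v : V) :
    @cocycle k A (cone e) i (w, v) -> cobound (i + 1) w ->
    exists2 v', cocycle i v' & @cobound k A (cone e) i ((w, v) - (0, v')).
  move=> [[pw pv] [dw dv]] [w' pw' dw']; rewrite /= in pv dv pw'.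
  rewrite addrK in pw'.
  exists (v + e w').
    by split; rewrite raddfD /= -?dgh_gr -?dgh_d ?pw' ?pv ?dw' // addrC.
  exists (- w', 0).
    by rewrite /= /pair_fun /= raddf0 subrK raddfN pw'.
  by apply: pair_ext; rewrite /= !raddfN ?raddf0 /= ?dw'; zmod.
have cone_in_cocycle (W V : dgMod) (e : dgHom W V) v :
    cocycle i v -> @cocycle k A (cone e) i (0, v).
  by move=> cv; apply: (dgh_cocycle (cone_in e)).
have fstC (W V : dgMod) (e : dgHom W V) w v :
    @cocycle k A (cone e) i (w, v) -> cocycle (i + 1) w /\ cobound (i + 1)
      (e w).
  move=> [[pw pv] [dw dv]]; rewrite /= in pw pv dw dv.
  split; first by split=> //; apply/eqP; rewrite -oppr_eq0 dw.
  exists (- v); first by rewrite raddfN addrK pv.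
  by rewrite raddfN; apply/eqP; rewrite eq_sym -addr_eq0 dv.
split=> [[x y] cxy bg|[x' y'] cxy'].
  have bx : cobound (i + 1) x.
    apply: (qa _).1; first by have [] := fstC _ _ _ _ _ cxy.
    case: bg => [[z v] [pz pv] /(congr1 fst)]; rewrite g1 /= => dz.
    exists (- z); first by rewrite addrK raddfN /= -{1}(subrK 1 i) pz.
    by rewrite raddfN dz.
  have [y1 cy1 by1] := cone_cob _ _ _ _ _ cxy bx.
  rewrite -(subrK (0, y1) (x, y)); apply: coboundD => //.
  have : @cobound k A (cone f') i (0, b y1).
    rewrite -g2 -(subKr (g (x, y)) (g (0, y1))) -raddfB.
    by apply: coboundB => //; apply: dgh_cobound.
  case=> [[z v] [pz pv] [dz dv]]; rewrite /= in pz pv dz dv.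
  rewrite subrK in pz.
  (* The first coordinate [z] of a primitive of (0, b y1) is a cocycle. Its lift [w] along [a] gives
     the correction f w after which [y1] bounds in Y. *)
  have [|w [pw dw] [w' pw' dw']] := (qa i).2 z.
    by split=> //; apply/eqP; rewrite -oppr_eq0 dz.
  have gw0 : g (d (cone f) (w, 0)) = d (cone f') (a w, (g (w, 0)).2).
    by rewrite dgh_d -(g1 (w, 0)); case: (g _).
  have dw0 : d (cone f) (w, 0) = (0, f w).
    by apply: pair_ext; rewrite /= ?dw ?oppr0 ?raddf0 ?addr0.
  have [v0 pv0 dv0] : cobound i (y1 - f w).
    apply: (qb i).1.
      by apply: cocycleB => //; apply: dgh_cocycle.
    exists (v - (g (w, 0)).2 - f' w').
      have /(congr1 snd) /= E := dgh_gr g (i - 1) (w, 0).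
      rewrite /pair_fun /= subrK raddf0 pw in E.
      by rewrite !raddfB /= -dgh_gr pv pw' -E.
    move: gw0; rewrite dw0 g2 => /(congr1 snd) /= bfw.
    rewrite !raddfB /= bfw -dgh_d dw' raddfB /= -dv; zmod.
  exists (w, v0); first by rewrite /= /pair_fun /= subrK pw pv0.
  by apply: pair_ext; rewrite /= ?dw ?oppr0 // dv0; zmod.
(* Surjectivity: the first coordinate is lifted to [x] and completed to a cocycle (x, - y0); the
   remaining difference is cohomologous to a cocycle of Y' and is lifted along [b]. *)
move: cxy' => cxy'; have [cx' bx'] := fstC _ _ _ _ _ cxy'.
have [x cx bx] := (qa _).2 _ cx'.
have dw0 : d (cone f) (x, 0) = (0, f x).
  by case: cx => _ dx; apply: pair_ext; rewrite /= ?dx ?oppr0 ?raddf0 ?addr0.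
have [y0 py0 dy0] : cobound (i + 1) (f x).
  apply: (qb _).1; first exact: dgh_cocycle.
  have : d (cone f') (g (x, 0)) = (0, b (f x)) by rewrite -dgh_d dw0 g2.
  move=> /(congr1 snd) /=; rewrite g1 /= => <-.
  apply: coboundD.
    rewrite -(subrK (f' x') (f' (a x))); apply: coboundD => //.
    by rewrite -raddfB; apply: dgh_cobound.
  exists (g (x, 0)).2 => //.
  have /(congr1 snd) /= E := dgh_gr g (i + 1 - 1) (x, 0).
  by rewrite /pair_fun /= subrK raddf0 (proj1 cx) in E.
rewrite addrK in py0.
have cxy : @cocycle k A (cone f) i (x, - y0).
  case: cx => px dx; split; apply: pair_ext; rewrite /= ?raddfN /= ?py0 //.
    by rewrite dx oppr0.
  by rewrite dy0 subrr.
have := cone_cob _ _ f' (a x - x') ((g (x, - y0)).2 - y') _ bx.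
case=> [|v' cv' bv'].
  have -> : (a x - x', (g (x, - y0)).2 - y') = g (x, - y0) - (x', y') :> cone
    f'.
    by apply: pair_ext; rewrite /= ?g1.
  by apply: cocycleB => //; apply: dgh_cocycle.
have [y cy by_] := (qb i).2 _ cv'.
exists ((x, - y0) - (0, y)).
  by apply: cocycleB => //; apply: cone_in_cocycle.
have -> : g ((x, - y0) - (0, y)) - (x', y') =
    ((a x - x', (g (x, - y0)).2 - y') - (0, v')) - (0, b y - v') :> cone f'.
  by rewrite raddfB /= g2; apply: pair_ext; rewrite /= ?g1 /=; zmod.
by apply: coboundB => //; apply: (dgh_cobound (cone_in f')).
Qed.
End ConeMap.
End ConeMaps.

(** * Invariance of cones and exactness of Hom along them *)

Section ConeSequences.
Variables (k : comPzRingType) (A : dgAlg k).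
Local Notation dgMod := (dgMod A).
Local Notation pr X i := (dgm_gr X i).
Local Notation d X := (dgm_d X).
Implicit Types X Y Z W T N : dgMod.

Lemma qeq_cone_square X Y X' Y' (f : dgHom X Y) (f' : dgHom X' Y')
    (a : dgHom X X') (b : dgHom Y Y') :
  qiso a -> qiso b -> homotopic (dgcomp b f) (dgcomp f' a) ->
  qeq (cone f) (cone f').
Proof.
move=> qa qb /cone_map[g [g2 g1]]; apply: (@qiso_qeq _ _ _ _ g).
exact: qiso_cone qa qb g2 g1.
Qed.

(** A square commuting only in the derived category is replaced by squares commuting up to homotopy:
    [b] becomes a left fraction, [a] is a right fraction, and a further quasi-isomorphism [p]
    equalises the two composites. The cones then form a zigzag. *)
Lemma qeq_cone X Y X' Y' (f : dgHom X Y) (f' : dgHom X' Y')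
    (a : dHom X X') (b : dHom Y Y') :
  diso a -> diso b -> deq (dcomp b (dloc f)) (dcomp (dloc f') a) ->
  qeq (cone f) (cone f').
Proof.
move=> da db bf; have [V [t [b1 [qt tb]]]] := left_roof b.
have qb1 : qiso b1.
  exact: (diso_qiso (diso_proper tb (diso_comp db (qiso_diso qt)))).
have qs := dwit_qiso a; have qa1 := diso_qiso da.
set s := dwit a in qs; set a1 := dleg a in qa1.
have /dloc_eqP[W [p [qp sq]]] :
    deq (dloc (dgcomp b1 (dgcomp f s))) (dloc (dgcomp t (dgcomp f' a1))).
  rewrite -!dloc_comp -tb -(dcompA _ b) (dcompA _ _ b) bf -!dcomp_wit.
  by rewrite -!dcompA.
have qsp := qiso_comp qs qp; have qap := qiso_comp qa1 qp.
pose m := dgcomp (dgcomp f s) p; pose m' := dgcomp (dgcomp f' a1) p.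
apply: (@qeq_trans _ _ _ (cone m)).
  apply: qeq_sym; apply: qeq_cone_square qsp (@qiso_id _ A Y) _.
  exact: eq_homotopic.
apply: (@qeq_trans _ _ _ (cone (dgcomp t m'))).
  apply: qeq_cone_square (@qiso_id _ A W) qb1 _.
  by apply: eq_homotopicW sq _ _.
apply: (@qeq_trans _ _ _ (cone m')).
  apply: qeq_sym; apply: qeq_cone_square (@qiso_id _ A W) qt _.
  exact: eq_homotopic.
apply: qeq_cone_square qap (@qiso_id _ A Y') _.
exact: eq_homotopic.
Qed.

Lemma cone_in_comp X Y (f : dgHom X Y) :
  homotopic (dgcomp (cone_in f) f) (dgzero X (cone f)).
Proof.
apply: (@homotopicI _ _ X (cone f) _ _ (fun x => (x, 0))).
- by move=> a x y; congr (_, _); rewrite /= scaler0 addr0.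
- by move=> i x; apply: pair_ext; rewrite /= ?subrK ?raddf0.
- by move=> x; apply: pair_ext; rewrite /= ?raddf0; zmod.
Qed.

(** A null-homotopy into the cone has two coordinates: the first is the lift to X, the second the
    homotopy comparing it with the given map. *)
Lemma lift_cone_in X Y T (f : dgHom X Y) (u : dHom T Y) :
  deq (dcomp (dloc (cone_in f)) u) (dzero T (cone f)) ->
  exists v : dHom T X, deq u (dcomp (dloc f) v).
Proof.
rewrite -[u in dcomp _ u]dcomp_idr -(dinvr (dwit_qiso u)) (dcompA _ _ u)
  dcomp_wit.
rewrite dcompA dloc_comp => u0.
have /dloc_eqP[W [s [qs [h hgr hd]]]] :
    deq (dloc (dgcomp (cone_in f) (dleg u))) (dloc (dgzero _ _)).
  rewrite -[dloc (dgcomp _ _)]dcomp_idr -(dinvl (dwit_qiso u)) dcompA u0.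
  by rewrite dcomp0l.
have hl : linear (fun w => (h w).1).
  by move=> a x y; rewrite linearP.
have hg i w : (h (pr W i w)).1 = pr X i (h w).1.
  by rewrite hgr /= subrK.
have hd1 w : (h (d W w)).1 = d X (h w).1.
  have /(congr1 fst) /= := hd w; rewrite subr0 => /esym /eqP.
  by rewrite addrC subr_eq0 => /eqP.
pose g := dgHom_of hl hg hd1.
have qs' := qiso_comp (dwit_qiso u) qs.
exists (DHom qs' g).
have H := @dcompE _ _ _ _ _ (DHom qs' g) (dloc f) _ (dgid _) g (@qiso_id _ A _).
apply: deq_trans (deq_sym (H _)); last exact: eq_homotopic.
apply: (@deq_refine _ _ _ _ _ _ _ _ s); first exact: eq_homotopic.
apply: (@homotopicI _ _ W Y _ _ (fun w => (h w).2)).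
- by move=> a x y; rewrite linearP.
- by move=> i w; rewrite hgr.
- move=> w; have /(congr1 snd) /= := hd w; rewrite subr0 => ->; zmod.
Qed.

(** A null-homotopy [h] of the first coordinate corrects the second one: w -> (e w).2 - f (h w)
    commutes with the differentials, and its image in the cone is homotopic to [e]. *)
Lemma lift_cone_out X Y T (f : dgHom X Y) (u : dHom T (cone f)) :
  deq (dcomp (dloc (cone_out f)) u) (dzero T (shift 1 X)) ->
  exists v : dHom T Y, deq u (dcomp (dloc (cone_in f)) v).
Proof.
rewrite -[u in dcomp _ u]dcomp_idr -(dinvr (dwit_qiso u)) (dcompA _ _ u)
  dcomp_wit.
rewrite dcompA dloc_comp => u0.
have /dloc_eqP[W [s [qs [h hgr hd]]]] :
    deq (dloc (dgcomp (cone_out f) (dleg u))) (dloc (dgzero _ _)).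
  rewrite -[dloc (dgcomp _ _)]dcomp_idr -(dinvl (dwit_qiso u)) dcompA u0.
  by rewrite dcomp0l.
pose e := dgcomp (dleg u) s.
have gl : linear (fun w => (e w).2 - f (h w)).
  by move=> a x y; rewrite [e _]linearP [h _]linearP [f _]linearP /= scalerBr;
    zmod.
have hgr' i w : h (pr W i w) = pr X i (h w) by rewrite hgr /= subrK.
have gg i w : (e (pr W i w)).2 - f (h (pr W i w)) = pr Y i ((e w).2 - f (h w)).
  by rewrite hgr' dgh_gr raddfB /= dgh_gr.
have gd w : (e (d W w)).2 - f (h (d W w)) = d Y ((e w).2 - f (h w)).
  have /= := hd w; rewrite subr0 => E.
  rewrite raddfB /= -!dgh_d.
  have -> : h (d W w) = (e w).1 + d X (h w) by rewrite /= E /ksgn /=; zmod.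
  by have /(congr1 snd) /= -> := dgh_d e w; rewrite raddfD /=; zmod.
pose g := dgHom_of gl gg gd.
have qs' := qiso_comp (dwit_qiso u) qs.
exists (DHom qs' g).
have H := @dcompE _ _ _ _ _ (DHom qs' g) (dloc (cone_in f)) _ (dgid _) g
  (@qiso_id _ A _).
apply: deq_trans (deq_sym (H _)); last exact: eq_homotopic.
apply: (@deq_refine _ _ _ _ _ _ _ _ s); first exact: eq_homotopic.
apply: (@homotopicI _ _ W (cone f) _ _ (fun w => (h w, 0))).
- by move=> a x y; apply: pair_ext; rewrite /= ?linearP // scaler0 addr0.
- by move=> i w; apply: pair_ext; rewrite /= ?hgr' ?subrK ?raddf0.
- move=> w; have /= := hd w; rewrite subr0 => E.
  apply: pair_ext; rewrite /= ?raddf0; last by zmod.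
  by rewrite E /ksgn /=; zmod.
Qed.

(** The counterpart for maps out of the cone, for homotopy classes: the null-homotopy [h] on Y
    corrects g (x, 0) by - h (f x). *)
Lemma cone_factor X Y T (f : dgHom X Y) (g : dgHom (cone f) T) :
  homotopic (dgcomp g (cone_in f)) (dgzero Y T) ->
  exists e : dgHom (shift 1 X) T, homotopic g (dgcomp e (cone_out f)).
Proof.
case=> h hgr hd.
have el : linear (fun x : shift 1 X => g (x, 0) - h (f x)).
  move=> a x y.
  have -> : (a *: x + y, 0) = a *: ((x, 0) : cone f) + (y, 0).
    by apply: pair_ext; rewrite //= scaler0 addr0.
  by rewrite [g _]linearP [f _]linearP [h _]linearP /= scalerBr; zmod.
have egr i (x : shift 1 X) : g (pr (shift 1 X) i x, 0) - h
  (f (pr (shift 1 X) i x))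
    = pr T i (g (x, 0) - h (f x)).
  rewrite [in RHS]raddfB /= -(dgh_gr g) (dgh_gr f) hgr addrK; congr (g _ - _).
  by apply: pair_ext; rewrite /= ?raddf0.
have ed (x : shift 1 X) : g (d (shift 1 X) x, 0) - h (f (d (shift 1 X) x))
    = d T (g (x, 0) - h (f x)).
  have -> : (d (shift 1 X) x, 0) = d (cone f) (x, 0) - cone_in f (f x).
    by apply: pair_ext; rewrite /= ?raddf0 /ksgn /=; zmod.
  have /= := hd (f x); rewrite subr0 => E.
  have -> (p q : cone f) : g (p - q) = g p - g q := raddfB g p q.
  rewrite (dgh_d g) [in RHS]raddfB /= E /ksgn /= !raddfN /= -(dgh_d f); zmod.
exists (dgHom_of el egr ed).
apply: (@homotopicI _ _ (cone f) T _ _ (fun p => h p.2)).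
- by move=> a x y; rewrite /= linearP.
- by move=> i x; rewrite -hgr.
- move=> [x y] /=.
  have /= := hd y; rewrite subr0 => E.
  have -> : (x, y) = ((x, 0) : cone f) + cone_in f y.
    by apply: pair_ext; rewrite /=; zmod.
  have -> (p q : cone f) : g (p + q) = g p + g q := raddfD g p q.
  by rewrite /= E [h (_ + _)]raddfD /=; zmod.
Qed.

Definition acyclic N := forall i, cohom0 N i.

Lemma qiso_acyclic X Y (f : dgHom X Y) : qiso f -> acyclic (cone f).
Proof.
move=> qf i [x y] [[px py] [dx dy]]; rewrite /= in px py dx dy.
have {}dx : d X x = 0 by apply/eqP; rewrite -oppr_eq0 dx.
have [x' px' dx'] : cobound (i + 1) x.
  apply: (qf _).1 => //; exists (- y); first by rewrite addrK raddfN py.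
  by rewrite raddfN; apply/eqP; rewrite eq_sym -addr_eq0 dy.
rewrite addrK in px'.
have [|x1 [px1 dx1] [y1 py1 dy1]] := (qf i).2 (y + f x').
  split; first by rewrite raddfD /= -dgh_gr px' py.
  by rewrite raddfD /= -dgh_d dx' addrC.
exists (x1 - x', - y1).
  by apply: pair_ext; rewrite /= ?subrK ?raddfN ?py1 // raddfB /= px1 px'.
apply: pair_ext; rewrite /= raddfB /=; first by rewrite dx1 dx'; zmod.
by rewrite raddfN /= dy1; zmod.
Qed.

Lemma qiso_cone_in X Y (f : dgHom X Y) : acyclic X -> qiso (cone_in f).
Proof.
move=> aX i; split=> [y cy [[x y'] [px py] [dx dy]]|[x y] [[px py] [dx dy]]];
    rewrite /= in px py dx dy.
  have [|x' px' dx'] := aX i x.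
    by rewrite subrK in px; split=> //; apply/eqP; rewrite -oppr_eq0 dx.
  exists (f x' + y'); first by rewrite raddfD /= -dgh_gr px' py.
  by rewrite raddfD /= -dgh_d dx' dy.
have [|x' px' dx'] := aX (i + 1) x.
  by split=> //; apply/eqP; rewrite -oppr_eq0 dx.
rewrite addrK in px'.
exists (y + f x').
  split; first by rewrite raddfD /= -dgh_gr px' py.
  by rewrite raddfD /= -dgh_d dx' addrC.
exists (x', 0); first by apply: pair_ext; rewrite /= ?subrK ?raddf0.
by apply: pair_ext; rewrite /= ?raddf0 ?dx'; zmod.
Qed.

(** A null-homotopy of [g s] extends [g] to a map [e] on the acyclic cone of [s]. The inclusion of Y
    in the cone of [e] is then a quasi-isomorphism that kills [e], hence [g]. *)
Lemma dloc0_left X Y (g : dgHom X Y) : deq (dloc g) (dzero X Y) ->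
  exists Y' (t : dgHom Y Y'),
    qiso t /\ homotopic (dgcomp t g) (dgzero X Y').
Proof.
case/dloc_eqP=> W [s [qs [h hgr hd]]].
have el : linear (fun p : cone s => h p.1 + g p.2).
  by move=> a x y; rewrite !linearP /= scalerDr; zmod.
have eg i (p : cone s) : h (pr (cone s) i p).1 + g (pr (cone s) i p).2
    = pr Y i (h p.1 + g p.2).
  by rewrite raddfD /= hgr addrK dgh_gr.
have ed (p : cone s) : h (d (cone s) p).1 + g (d (cone s) p).2
    = d Y (h p.1 + g p.2).
  have /= := hd p.1; rewrite subr0 => E.
  by rewrite /= raddfN !raddfD /= E dgh_d; zmod.
pose e := dgHom_of el eg ed.
exists (cone e), (cone_in e); split; first exact/qiso_cone_in/qiso_acyclic.
apply: eq_homotopicW (homotopic_compr (cone_in s) (cone_in_comp e)) _ _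
  => // x /=.
by rewrite raddf0 add0r.
Qed.

(** To use the strict factorisation through [cone_out], a map out of the cone is made strict by
    changing its target; [dloc0_left] then turns vanishing in the derived category into a
    null-homotopy. *)
Lemma hz_cone_left X Y T (f : dgHom X Y) :
  hz Y T -> hz (shift 1 X) T -> hz (cone f) T.
Proof.
move=> zY zX u; have [T1 [t [g [qt tu]]]] := left_roof u.
have qT1 : qeq T T1 := qiso_qeq qt.
have [T2 [t2 [qt2 gi0]]] : exists Y' (t : dgHom T1 Y'),
    qiso t /\ homotopic (dgcomp t (dgcomp g (cone_in f))) (dgzero Y Y').
  by apply: dloc0_left; apply: hz_qeq (qeq_refl _) qT1 zY _.
have [|e ge] := @cone_factor _ _ _ f (dgcomp t2 g).
  exact: eq_homotopicW gi0 _ _.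
have qt' := qiso_comp qt2 qt.
have e0 : deq (dloc e) (dzero _ _).
  by apply: hz_qeq (qeq_refl _) (qiso_qeq qt') zX _.
rewrite -[u]dcomp_idl -(dinvl qt') -dcompA -dloc_comp -dcompA tu.
by rewrite dloc_comp (dloc_homotopic ge) -dloc_comp e0 dcomp0l dcomp0.
Qed.

Lemma hz_cone_right X Y T (f : dgHom X Y) :
  hz T Y -> hz T (shift 1 X) -> hz T (cone f).
Proof.
move=> zY zX u; have [v ->] := lift_cone_out (zX (dcomp (dloc (cone_out f)) u)).
by rewrite (zY v) dcomp0.
Qed.

Lemma hz_cone_middle X Y T (f : dgHom X Y) :
  hz T X -> hz T (cone f) -> hz T Y.
Proof.
move=> zX zC u; have [v ->] := lift_cone_in (zC (dcomp (dloc (cone_in f)) u)).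
by rewrite (zX v) dcomp0.
Qed.
End ConeSequences.

(** * Shifts and the octahedral axiom *)

Section StrictIsomorphisms.
Variables (k : comPzRingType) (A : dgAlg k).
Local Notation dgMod := (dgMod A).
Local Notation pr X i := (dgm_gr X i).
Local Notation d X := (dgm_d X).
Implicit Types X Y Z W T N : dgMod.

Lemma qiso_bij X Y (f : dgHom X Y) (g : Y -> X) :
  cancel f g -> cancel g f -> qiso f.
Proof.
move=> fK gK; have fI := can_inj fK.
move=> i; split=> [x [px dx] [y py dy]|y [py dy]].
  exists (g y); first by apply: fI; rewrite dgh_gr gK.
  by apply: fI; rewrite dgh_d gK.
exists (g y); last by rewrite gK subrr; apply: cobound0.
by split; apply: fI; rewrite ?dgh_gr ?dgh_d gK // dy raddf0.
Qed.

Lemma qeq_bij X Y (f : X -> Y) (g : Y -> X) : linear f ->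
  (forall i x, f (pr X i x) = pr Y i (f x)) ->
  (forall x, f (d X x) = d Y (f x)) -> cancel f g -> cancel g f -> qeq X Y.
Proof.
move=> fl fgr fd fK gK; apply: (@qiso_qeq _ _ _ _ (dgHom_of fl fgr fd)).
exact: (@qiso_bij _ _ (dgHom_of fl fgr fd) g fK gK).
Qed.

Lemma qeq_shift n X Y : qeq X Y -> qeq (shift n X) (shift n Y).
Proof.
case=> W [s [t [qs qt]]]; exists (shift n W), (shift_hom n s), (shift_hom n t).
by split; apply: qiso_shift.
Qed.

Lemma qeq_shiftD m n X : qeq (shift n (shift m X)) (shift (m + n) X).
Proof.
apply: (@qeq_bij (shift n (shift m X)) (shift (m + n) X) id id)
  => // [i x|x] /=.
  by congr (pr X _ _); rewrite (addrC m) addrA.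
by rewrite addrC ksgnD.
Qed.

(** The carriers agree but the gradings are not convertible. That the comparison map is the identity
    on elements is recorded so that later equations hold pointwise. *)
Lemma shift0_dgHom m n X : m + n = 0 ->
  exists e : dgHom (shift n (shift m X)) X, qiso e /\ e =1 id.
Proof.
move=> mn.
have fgr i (x : shift n (shift m X)) :
    (pr (shift n (shift m X)) i x : X) = pr X i x.
  by congr (pr X _ _); rewrite /= -addrA (addrC n) mn addr0.
have fd (x : shift n (shift m X)) : (d (shift n (shift m X)) x : X) = d X x.
  by rewrite /= -ksgnD addrC mn.
have fl : linear (id : shift n (shift m X) -> X) by [].
exists (dgHom_of fl fgr fd); split=> //.
exact: (@qiso_bij _ _ (dgHom_of fl fgr fd) id).
Qed.

Lemma qeq_shiftK m n X : m + n = 0 -> qeq (shift n (shift m X)) X.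
Proof. by case/(shift0_dgHom X)=> e [qe _]; apply: qiso_qeq qe. Qed.

Lemma qeq_shift0 X : qeq (shift 0 X) X.
Proof.
apply: (@qeq_bij (shift 0 X) X id id) => // i x /=.
by rewrite addr0.
Qed.

Lemma qeq_shift_inj n X Y : qeq (shift n X) (shift n Y) -> qeq X Y.
Proof.
move=> /(qeq_shift (- n)) H; apply: qeq_trans (qeq_sym _) (qeq_trans H _);
by apply: qeq_shiftK; rewrite subrr.
Qed.

Lemma ksgn_fst (V W : zmodType) n (p : V * W) : (ksgn n p).1 = ksgn n p.1.
Proof. by rewrite /ksgn; case: odd. Qed.

Lemma ksgn_snd (V W : zmodType) n (p : V * W) : (ksgn n p).2 = ksgn n p.2.
Proof. by rewrite /ksgn; case: odd. Qed.

(** The shifted differential multiplies [f] by (-1)^n, the cone of the shifted map does not; the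
    sign on the first coordinate reconciles them. *)
Lemma qeq_shift_cone n X Y (f : dgHom X Y) :
  qeq (shift n (cone f)) (cone (shift_hom n f)).
Proof.
apply: (@qeq_bij (shift n (cone f)) (cone (shift_hom n f))
  (fun p => (ksgn n p.1, p.2)) (fun p => (ksgn n p.1, p.2))).
- by move=> a p q; rewrite !linearP.
- move=> i p; apply: pair_ext; rewrite //= raddf_ksgn.
  by congr (ksgn _ (pr X _ _)); rewrite addrAC.
- move=> p; apply: pair_ext; rewrite /= ?ksgn_fst ?ksgn_snd /=.
    by apply: etrans (ksgnK n (- d X p.1)) _;
      rewrite (raddf_ksgn (dgm_d X)) ksgnK.
  by apply: etrans (ksgn_add n (f p.1) (d Y p.2)) _; rewrite (raddf_ksgn f).
- by move=> p; apply: pair_ext; rewrite /= ?ksgnK.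
- by move=> p; apply: pair_ext; rewrite /= ?ksgnK.
Qed.

Lemma qeq_shift_prod n X Y :
  qeq (shift n (prodm X Y)) (prodm (shift n X) (shift n Y)).
Proof.
apply: (@qeq_bij (shift n (prodm X Y)) (prodm (shift n X) (shift n Y)) id id)
  => // x /=.
by rewrite /ksgn /pair_fun /=; case: odd.
Qed.

(** A roof between shifted modules is shifted back, becomes null-homotopic there after a
    quasi-isomorphism, and the null-homotopy is shifted forward again. *)
Lemma hz_shift n X Y : hz X Y -> hz (shift n X) (shift n Y).
Proof.
move=> z u; apply/deq0P.
have [eX [qX eXE]] := shift0_dgHom X (subrr n).
have [eY [_ eYE]] := shift0_dgHom Y (subrr n).
have [eW [qW eWE]] := shift0_dgHom (apex u) (addNr n).
have qs := qiso_comp qX (qiso_shift (- n) (dwit_qiso u)).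
have [V [t [qt g0]]] :=
  (deq0P _).1 (z (DHom qs (dgcomp eY (shift_hom (- n) (dleg u))))).
exists (shift n V), (dgcomp eW (shift_hom n t)); split.
  exact: qiso_comp qW (qiso_shift n qt).
apply: eq_homotopicW (homotopic_shift n g0) _ _ => // x.
by rewrite [RHS]/= eWE /= eYE.
Qed.

Lemma hz_retractl X S T (i : dgHom X S) (r : dgHom S X) :
  homotopic (dgcomp r i) (dgid X) -> hz S T -> hz X T.
Proof.
move=> ri z u.
have ri1 : deq (did X) (dloc (dgcomp r i)) := dloc_homotopic (homotopic_sym ri).
rewrite -(dcomp_idr u) ri1 -dloc_comp dcompA.
by rewrite (z (dcomp u (dloc r))) dcomp0l.
Qed.

Lemma hz_retractr X S T (i : dgHom X S) (r : dgHom S X) :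
  homotopic (dgcomp r i) (dgid X) -> hz T S -> hz T X.
Proof.
move=> ri z u.
have ri1 : deq (did X) (dloc (dgcomp r i)) := dloc_homotopic (homotopic_sym ri).
rewrite -(dcomp_idl u) ri1 -dloc_comp -dcompA.
by rewrite (z (dcomp (dloc i) u)) dcomp0.
Qed.

Lemma prod_in1K X Y : homotopic (dgcomp (prod_fst X Y) (prod_in1 X Y)) (dgid X).
Proof. exact: eq_homotopic. Qed.

Lemma qeq_prodC X Y : qeq (prodm X Y) (prodm Y X).
Proof.
by apply: (@qeq_bij (prodm X Y) (prodm Y X) (fun p => (p.2, p.1))
  (fun p => (p.2, p.1))) => // -[].
Qed.

Lemma qeq_prodA X Y Z : qeq (prodm (prodm X Y) Z) (prodm X (prodm Y Z)).
Proof.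
by apply: (@qeq_bij (prodm (prodm X Y) Z) (prodm X (prodm Y Z))
  (fun p => (p.1.1, (p.1.2, p.2))) (fun p => ((p.1, p.2.1), p.2.2)))
  => // [[[]]|[? []]].
Qed.

Lemma qeq_cone0 X Y : qeq (cone (dgzero X Y)) (prodm (shift 1 X) Y).
Proof.
apply: (@qeq_bij (cone (dgzero X Y)) (prodm (shift 1 X) Y) id id) => // p.
by apply: pair_ext; rewrite //= add0r.
Qed.

(** Serves to extend a map between direct summands by zero to the ambient modules: the cone only
    gains the complements. *)
Lemma qeq_cone_prod X Y X' Y' (f : dgHom X Y) :
  qeq (cone (prod_pair (dgcomp f (prod_fst X X')) (dgzero (prodm X X') Y')))
      (prodm (cone f) (prodm (shift 1 X') Y')).
Proof.
apply: (@qeq_bij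
  (cone (prod_pair (dgcomp f (prod_fst X X')) (dgzero (prodm X X') Y')))
  (prodm (cone f) (prodm (shift 1 X') Y'))
  (fun p => ((p.1.1, p.2.1), (p.1.2, p.2.2)))
  (fun p => ((p.1.1, p.2.1), (p.1.2, p.2.2)))) => //.
- by move=> p; do 2!apply: pair_ext; rewrite //= add0r.
- by move=> [[? ?] [? ?]].
- by move=> [[? ?] [? ?]].
Qed.

(** The two copies of Z in the cone of [phi] contract each other, which leaves the coordinates in X
    and Y. Of the third triangle, the conclusion keeps the isomorphism class of the cone. *)
Lemma octahedral X Y Z (f : dgHom X Y) (g : dgHom Y Z) :
  exists phi : dgHom (cone (dgcomp g f)) (cone g),
    qeq (cone phi) (shift 1 (cone f)).
Proof.
set gf := dgcomp g f.
have [] : [/\ linear (fun p : cone gf => (f p.1, p.2) : cone g),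
    forall i p, (f (pr (cone gf) i p).1, (pr (cone gf) i p).2)
                = pr (cone g) i (f p.1, p.2) &
    forall p, (f (d (cone gf) p).1, (d (cone gf) p).2)
                = d (cone g) (f p.1, p.2)].
  split=> [a p q|i p|p]; apply: pair_ext; rewrite //= ?linearP ?dgh_gr //.
  by rewrite raddfN /= dgh_d.
move=> pl pgr pd; pose phi := dgHom_of pl pgr pd; exists phi.
have [] : [/\ linear (fun p : shift 1 (cone f) => ((p.1, g p.2), (- p.2, 0)) :
  cone phi),
    forall i (p : shift 1 (cone f)),
      (((pr (shift 1 (cone f)) i p).1, g (pr (shift 1 (cone f)) i p).2),
       (- (pr (shift 1 (cone f)) i p).2, 0))
      = pr (cone phi) i ((p.1, g p.2), (- p.2, 0)) &
    forall p : shift 1 (cone f),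
      (((d (shift 1 (cone f)) p).1, g (d (shift 1 (cone f)) p).2),
       (- (d (shift 1 (cone f)) p).2, 0))
      = d (cone phi) ((p.1, g p.2), (- p.2, 0))].
  split=> [a p q|i p|p]; do 2!apply: pair_ext; rewrite //=.
  - by rewrite linearP.
  - by rewrite linearP /= scalerN; zmod.
  - by rewrite scaler0 addr0.
  - by rewrite dgh_gr.
  - by rewrite raddfN.
  - by rewrite raddf0.
  - by rewrite !raddfN raddfD /= -dgh_d; zmod.
  - by rewrite (raddfN (dgm_d Y)) /=; zmod.
  - by rewrite raddf0 raddfN /=; zmod.
move=> il igr id; pose e := dgHom_of il igr id.
have [] : [/\ linear (fun p : cone phi => (p.1.1, - p.2.1) : shift 1 (cone f)),
    forall i (p : cone phi), ((pr (cone phi) i p).1.1, -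
      (pr (cone phi) i p).2.1)
                = pr (shift 1 (cone f)) i (p.1.1, - p.2.1) &
    forall p : cone phi, ((d (cone phi) p).1.1, - (d (cone phi) p).2.1)
                = d (shift 1 (cone f)) (p.1.1, - p.2.1)].
  split=> [a p q|i p|p]; apply: pair_ext; rewrite //=.
  - by rewrite scalerN; zmod.
  - by rewrite raddfN.
  - by rewrite /ksgn /= raddfN /=; zmod.
move=> rl rgr rd; pose r := dgHom_of rl rgr rd.
apply: (@qiso_qeq _ _ _ _ r); apply: (@qiso_inverse _ _ _ _ r e); last first.
  by apply: eq_homotopic => p; apply: pair_ext; rewrite /= ?opprK.
apply: homotopic_sym.
apply: (@homotopicI _ _ (cone phi) (cone phi) _ _ (fun p => ((0, p.2.2), 0))).
- by move=> a p q; do 2!apply: pair_ext; rewrite /= ?scaler0 ?addr0.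
- by move=> i p; do 2!apply: pair_ext; rewrite /= ?subrK ?raddf0.
- move=> p; do 2!apply: pair_ext; rewrite /=.
  + by rewrite subrr raddf0 !oppr0 addr0.
  + by rewrite !raddf0 (raddfN g) /=; zmod.
  + by rewrite !raddf0; zmod.
  + by rewrite !raddf0; zmod.
Qed.

(** Rotation of the triangle: the two copies of Y contract each other. *)
Lemma qeq_cone_in X Y (f : dgHom X Y) : qeq (cone (cone_in f)) (shift 1 X).
Proof.
have [] : [/\ linear (fun x : shift 1 X => (- f x, (x, 0)) : cone (cone_in f)),
    forall i (x : shift 1 X),
      (- f (pr (shift 1 X) i x), (pr (shift 1 X) i x, 0))
      = pr (cone (cone_in f)) i (- f x, (x, 0)) &
    forall x : shift 1 X,
      (- f (d (shift 1 X) x), (d (shift 1 X) x, 0))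
      = d (cone (cone_in f)) (- f x, (x, 0))].
  split=> [a x y|i x|x].
  - apply: pair_ext; last by apply: pair_ext; rewrite //= scaler0 addr0.
    by rewrite /= linearP scalerN; zmod.
  - apply: pair_ext; last by apply: pair_ext; rewrite //= raddf0.
    by rewrite /= dgh_gr raddfN.
  - apply: pair_ext; last first.
      by apply: pair_ext; rewrite /= /ksgn /= ?raddf0; zmod.
    by rewrite /= /ksgn /= !raddfN /= dgh_d.
move=> il igr id; pose e := dgHom_of il igr id.
have [] : [/\ linear (fun p : cone (cone_in f) => p.2.1 : shift 1 X),
    forall i (p : cone (cone_in f)),
      (pr (cone (cone_in f)) i p).2.1 = pr (shift 1 X) i p.2.1 &
    forall p : cone (cone_in f),
      (d (cone (cone_in f)) p).2.1 = d (shift 1 X) p.2.1].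
  by split=> // p; rewrite /= /ksgn /= add0r.
move=> rl rgr rd; pose r := dgHom_of rl rgr rd.
apply: (@qiso_qeq _ _ _ _ r); apply: (@qiso_inverse _ _ _ _ r e); last first.
  exact: eq_homotopic.
apply: homotopic_sym.
apply: (@homotopicI _ _ (cone (cone_in f)) (cone (cone_in f)) _ _
  (fun p => (p.2.2, 0))).
- by move=> a p q; apply: pair_ext; rewrite //= scaler0 addr0.
- move=> i p; apply: pair_ext; rewrite /= ?subrK //.
  by apply: pair_ext; rewrite /= raddf0.
- move=> p; apply: pair_ext; first by rewrite /=; zmod.
  by apply: pair_ext; rewrite /= ?raddf0; zmod.
Qed.
End StrictIsomorphisms.

(** * Homotopically projective modules *)

Section HomotopicallyProjective.
Variables (k : comPzRingType) (A : dgAlg k).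
Local Notation dgMod := (dgMod A).
Local Notation pr X i := (dgm_gr X i).
Local Notation d X := (dgm_d X).
Implicit Types X Y Z W T N : dgMod.

Lemma cocycle_shift n X i (x : X) :
  @cocycle k A (shift n X) i x <-> @cocycle k A X (i + n) x.
Proof.
split=> [] [px dx]; split=> //; last by rewrite /= dx raddf0.
by apply: (can_inj (ksgnK n)); apply: etrans dx _; rewrite raddf0.
Qed.

Lemma cobound_shift n X i (x : X) :
  @cobound k A (shift n X) i x <-> @cobound k A X (i + n) x.
Proof.
split=> [] [y py dy]; exists (ksgn n y).
- by rewrite raddf_ksgn -[in RHS]py /= addrAC.
- by rewrite raddf_ksgn.
- by rewrite raddf_ksgn /= addrAC py.
- by rewrite /= raddf_ksgn ksgnK.
Qed.

Lemma cohom0_shift n X i : cohom0 X (i + n) -> cohom0 (shift n X) i.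
Proof. by move=> H x /cocycle_shift cx; apply/cobound_shift/H. Qed.

(** The module axiom concerns homogeneous scalars; decomposing [a] gives the components for every
    [a], so that a -> x a respects the gradings. *)
Lemma gr_scale X n i (x : X) (a : A^c) : pr X n x = x ->
  pr X (n + i) (a *: x) = (dga_gr A i a : A^c) *: x.
Proof.
move=> px; have [s _ as_] := gpr_sum (dga_gr A) a.
rewrite {1}(as_ : a = _ :> A^c) scaler_suml raddf_sum /=.
rewrite {2}(as_ : a = _ :> A^c) raddf_sum /= scaler_suml.
apply: eq_bigr => j _; rewrite gpr_orth.
rewrite -(@dgm_grM _ _ X n j x (dga_gr A j a) px);
  last by rewrite gpr_orth eqxx.
rewrite gpr_orth (inj_eq (addrI n)); case: eqP => [<-|_].
  by rewrite dgm_grM // gpr_orth eqxx.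
by rewrite scale0r.
Qed.

Lemma mulby X (x : X) (cx : cocycle 0 x) :
  exists f : dgHom (regular A) X, forall a, f a = (a : A^c) *: x.
Proof.
case: cx => px dx.
have fl : linear ((fun a => (a : A^c) *: x) : regular A -> X).
  by move=> c a b; rewrite scalerDl scalerA.
have fgr i (a : regular A) :
    (pr (regular A) i a : A^c) *: x = pr X i ((a : A^c) *: x).
  by rewrite -{2}[i]add0r gr_scale.
have fd (a : regular A) : (d (regular A) a : A^c) *: x = d X ((a : A^c) *: x).
  by rewrite (dgm_leibniz _ px) dx scaler0 add0r.
by exists (dgHom_of fl fgr fd).
Qed.

Lemma regularE X (f : dgHom (regular A) X) a : f a = (a : A^c) *: f 1.
Proof. by rewrite -linearZ; congr (f _); exact: esym (mul1r (a : A)). Qed.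

Lemma cocycle_regular1 X (f : dgHom (regular A) X) : cocycle 0 (f 1).
Proof.
apply: dgh_cocycle; split; first exact: dga_gr1.
(* The Leibniz rule for the product of 1 with itself reads d 1 = d 1 + d 1. *)
have := @dga_leibniz _ A 0 1 1 (dga_gr1 A); rewrite !mul1r mulr1 /ksgn /=.
by move/eqP; rewrite -subr_eq0 opprD addrA subrr sub0r oppr_eq0 => /eqP.
Qed.

Lemma regular_homotopic X (f g : dgHom (regular A) X) :
  cobound 0 (f 1 - g 1) -> homotopic f g.
Proof.
case=> y py dy; apply: (@homotopicI _ _ (regular A) X _ _
  (fun a => (a : A^c) *: y)).
- by move=> c a b; rewrite scalerDl scalerA.
- by move=> i a /=; rewrite addrC -(@gr_scale X (0 - 1)).
- move=> a /=; rewrite (dgm_leibniz _ py) dy scalerBr (regularE f a)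
    (regularE g a).
  by rewrite /ksgn /=; zmod.
Qed.

(** Lifting the class of 1 to the apex of a roof yields a quasi-isomorphism from A, along which the
    roof becomes multiplication of a cocycle of degree 0. *)
Lemma hz_regular X : cohom0 X 0 -> hz (regular A) X.
Proof.
move=> H u; apply/deq0P.
have c1 : cocycle 0 (1 : regular A) := cocycle_regular1 (dgid (regular A)).
have [w cw bw] := (dwit_qiso u 0).2 _ c1.
have [t tE] := mulby cw; exists (regular A), t; split; last first.
  apply: regular_homotopic; rewrite /= subr0; apply: H.
  exact: (cocycle_regular1 (dgcomp (dleg u) t)).
apply: (qiso_cancell (dwit_qiso u)); apply: (qiso_homotopic _ (@qiso_id _ A _)).
by apply/homotopic_sym/regular_homotopic; rewrite /= tE scale1r.
Qed.

Definition hproj Z := forall N, acyclic N ->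
  forall g : dgHom Z N, homotopic g (dgzero Z N).

Lemma hproj_regular : hproj (regular A).
Proof.
move=> N aN g; apply: regular_homotopic; rewrite subr0; apply: aN.
exact: cocycle_regular1.
Qed.

Lemma acyclic_shift n N : acyclic N -> acyclic (shift n N).
Proof. by move=> aN i; apply: cohom0_shift. Qed.

Lemma hproj_shift n Z : hproj Z -> hproj (shift n Z).
Proof.
move=> pZ N aN g.
have gl : linear (g : Z -> shift (- n) N) by exact: linearP.
have ggr i (x : Z) : g (pr Z i x) = pr (shift (- n) N) i (g x).
  by have /= := dgh_gr g (i - n) x; rewrite subrK.
have gd (x : Z) : g (d Z x) = d (shift (- n) N) (g x).
  have /= := dgh_d g x; rewrite raddf_ksgn => <-; rewrite -ksgnD addNr.
  by [].
have [h hgr hd] := pZ _ (acyclic_shift (n := - n) aN) (dgHom_of gl ggr gd).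
apply: (@homotopicI _ _ (shift n Z) N _ _ (fun z => ksgn n (h z))).
- by move=> a x y; rewrite !linearP.
- by move=> i x; rewrite /= hgr /= raddf_ksgn; congr (ksgn _ (pr N _ _)); lia.
- move=> x; have /= -> := hd x;
    rewrite (raddf_ksgn h) ksgnK (raddf_ksgn (dgm_d N)).
  congr (_ + _).
  rewrite /ksgn; have -> : odd `|(- n)%R|%N = odd `|n|%N by lia.
  by case: odd; rewrite ?raddfN.
Qed.

Lemma hproj_cone X Y (f : dgHom X Y) : hproj X -> hproj Y -> hproj (cone f).
Proof.
move=> pX pY N aN g.
have [|e ge] := @cone_factor _ _ _ _ _ f g; first exact: pY.
apply: homotopic_trans ge _.
apply: eq_homotopicW (homotopic_compr (cone_out f) (hproj_shift pX aN e)) _ _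
  => //.
Qed.

(** A null-homotopy of the inclusion of Z in the acyclic cone of the denominator splits the
    denominator up to homotopy, so the roof is represented by a morphism on Z itself. *)
Lemma hproj_roof Z Y (u : dHom Z Y) : hproj Z -> exists g, deq u (dloc g).
Proof.
move=> pZ.
have [h hgr hd] := pZ _ (qiso_acyclic (dwit_qiso u)) (cone_in (dwit u)).
have tl : linear (fun z => (h z).1) by move=> a x y; rewrite linearP.
have tgr i z : (h (pr Z i z)).1 = pr (apex u) i (h z).1.
  by rewrite hgr /= subrK.
have td z : (h (d Z z)).1 = d (apex u) (h z).1.
  have /(congr1 fst) /= := hd z; rewrite subr0 => /esym /eqP.
  by rewrite addrC subr_eq0 => /eqP.
pose t := dgHom_of tl tgr td; exists (dgcomp (dleg u) t).
have st : homotopic (dgcomp (dwit u) t) (dgid Z).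
  apply: homotopic_sym; apply: (@homotopicI _ _ Z Z _ _ (fun z => (h z).2)).
  - by move=> a x y; rewrite linearP.
  - by move=> i z; rewrite hgr.
  - by move=> z; have /(congr1 snd) /= := hd z; rewrite subr0 => E;
      rewrite /= {1}E; zmod.
have st1 : deq (did Z) (dloc (dgcomp (dwit u) t)) :=
  dloc_homotopic (homotopic_sym st).
by rewrite -[u in deq u _]dcomp_idr st1 -dloc_comp dcompA dcomp_wit dloc_comp.
Qed.
End HomotopicallyProjective.

(** * Direct sums *)

Lemma choice_dep (I : Type) (T : I -> Type) (P : forall i, T i -> Prop) :
  (forall i, exists x, P i x) -> exists f : forall i, T i, forall i, P i (f i).
Proof. by move=> H; exists (fun i => sval (cid (H i))) => i; case: cid. Qed.

Section DirectSum.
Variables (k : comPzRingType) (A : dgAlg k) (I : eqType) (X : I -> dgMod A).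
Local Notation pr X i := (dgm_gr X i).
Local Notation d X := (dgm_d X).

(** Finite support is a mere proposition, so an element is determined by its function; a support is
    chosen only when a sum is formed. Arbitrary index types enter later as [{classic I}]. *)
Record dsum_type := DSum {
  dsum_fun :> forall i, X i;
  dsum_fin : exists s : seq I, forall i, i \notin s -> dsum_fun i = 0 }.

Lemma dsum_ext (x y : dsum_type) : (forall i, x i = y i) -> x = y.
Proof.
case: x y => x fx [y fy] /= xy.
have {}xy : x = y by apply: functional_extensionality_dep.
by rewrite xy in fx *; congr DSum; apply: Prop_irrelevance.
Qed.

HB.instance Definition _ := gen_eqMixin dsum_type.
HB.instance Definition _ := gen_choiceMixin dsum_type.

Lemma dsum_fin_map (f : forall i, X i -> X i) (x : dsum_type) :
  (forall i, f i 0 = 0) ->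
  exists s : seq I, forall i, i \notin s -> f i (x i) = 0.
Proof.
by move=> f0; have [s sx] := dsum_fin x; exists s => i /sx ->.
Qed.

Definition dsum_endo (f : forall i, X i -> X i) (f0 : forall i, f i 0 = 0)
  (x : dsum_type) : dsum_type := DSum (dsum_fin_map x f0).

Lemma dsum_fin0 : exists s : seq I, forall i, i \notin s -> (0 : X i) = 0.
Proof. by exists [::]. Qed.

Lemma dsum_finD (x y : dsum_type) :
  exists s : seq I, forall i, i \notin s -> x i + y i = 0.
Proof.
have [s sx] := dsum_fin x; have [t ty] := dsum_fin y.
exists (s ++ t) => i; rewrite mem_cat negb_or => /andP[/sx -> /ty ->].
exact: addr0.
Qed.

Definition dsum0 := DSum dsum_fin0.
Definition dsum_add (x y : dsum_type) := DSum (dsum_finD x y).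
Definition dsum_opp := @dsum_endo (fun i => -%R) (fun i => oppr0 (X i)).
Definition dsum_scale (a : A^c) := @dsum_endo (fun i => *:%R a)
  (fun i => scaler0 (X i) a).

Lemma dsum_addA : associative dsum_add.
Proof. by move=> x y z; apply: dsum_ext => i; apply: addrA. Qed.
Lemma dsum_addC : commutative dsum_add.
Proof. by move=> x y; apply: dsum_ext => i; apply: addrC. Qed.
Lemma dsum_add0 : left_id dsum0 dsum_add.
Proof. by move=> x; apply: dsum_ext => i; apply: add0r. Qed.
Lemma dsum_addN : left_inverse dsum0 dsum_opp dsum_add.
Proof. by move=> x; apply: dsum_ext => i; apply: addNr. Qed.

HB.instance Definition _ := GRing.isZmodule.Build dsum_type
  dsum_addA dsum_addC dsum_add0 dsum_addN.

Lemma dsum_scaleA (a b : A^c) (x : dsum_type) :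
  dsum_scale a (dsum_scale b x) = dsum_scale (a * b) x.
Proof. by apply: dsum_ext => i; apply: scalerA. Qed.
Lemma dsum_scale1 : left_id (1 : A^c) dsum_scale.
Proof. by move=> x; apply: dsum_ext => i; apply: scale1r. Qed.
Lemma dsum_scaleDr : right_distributive dsum_scale +%R.
Proof. by move=> a x y; apply: dsum_ext => i; apply: scalerDr. Qed.
Lemma dsum_scaleDl (x : dsum_type) :
  {morph (dsum_scale)^~ x : a b / a + b}.
Proof. by move=> a b; apply: dsum_ext => i; apply: scalerDl. Qed.

HB.instance Definition _ := GRing.Zmodule_isLmodule.Build A^c dsum_type
  dsum_scaleA dsum_scale1 dsum_scaleDr dsum_scaleDl.

Section Endo.
Variable f : forall i, {additive X i -> X i}.

Definition dsum_add_endo := @dsum_endo f (fun i => raddf0 (f i)).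

Lemma dsum_endo_additive : zmod_morphism dsum_add_endo.
Proof. by move=> x y; apply: dsum_ext => i; apply: raddfB. Qed.

HB.instance Definition _ := GRing.isZmodMorphism.Build dsum_type dsum_type
  dsum_add_endo dsum_endo_additive.
End Endo.

Section Eval.
Variable i : I.
Definition dsum_eval (x : dsum_type) : X i := x i.
Lemma dsum_eval_linear : linear dsum_eval. Proof. by []. Qed.
HB.instance Definition _ := GRing.isLinear.Build A^c dsum_type (X i) *:%R
  dsum_eval dsum_eval_linear.
End Eval.

Lemma dsum_sumE (J : Type) (r : seq J) (F : J -> dsum_type) i :
  (\sum_(j <- r) F j) i = \sum_(j <- r) F j i.
Proof. exact: (raddf_sum (dsum_eval i)). Qed.

Program Definition dsum_gr : grading dsum_type :=
  @Grading dsum_type (fun n => dsum_add_endo (fun i => pr (X i) n)) _ _.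
Next Obligation.
move=> m n x; case: eqP => [mn|mn]; apply: dsum_ext => i /=; rewrite gpr_orth.
  by rewrite mn eqxx.
by case: eqP.
Qed.
Next Obligation.
move=> x; have [s sx] := dsum_fin x.
have /choice_dep[deg degP] (i : I) : exists t : seq int, uniq t /\
    x i = \sum_(n <- t) pr (X i) n (x i).
  by have [t ut et] := gpr_sum (dgm_gr (X i)) (x i); exists t.
(* All degrees occurring in the finitely many coordinates of the support. *)
exists (undup (flatten [seq deg i | i <- s])); first exact: undup_uniq.
apply: dsum_ext => i; rewrite dsum_sumE /=.
case si: (i \in s); last first.
  rewrite sx ?si // big1 // => n _; exact: raddf0.
have [ut et] := degP i.
apply: gpr_sumS et; rewrite ?undup_uniq // => n nt; rewrite mem_undup.
by apply/flatten_mapP; exists i.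
Qed.

Program Definition dsum : dgMod A :=
  @DgMod k A dsum_type dsum_gr (dsum_add_endo (fun i => d (X i))) _ _ _ _.
Next Obligation.
move=> m n x a px pa; apply: dsum_ext => i /=; apply: dgm_grM => //.
exact: (congr1 (dsum_eval i) px).
Qed.
Next Obligation. by move=> n x; apply: dsum_ext => i /=; apply: dgm_d_deg. Qed.
Next Obligation. by move=> x; apply: dsum_ext => i /=; apply: dgm_dd. Qed.
Next Obligation.
move=> n x a px; apply: dsum_ext => i /=.
rewrite (dgm_leibniz a (congr1 (dsum_eval i) px)).
by rewrite /ksgn; case: odd.
Qed.

Lemma dsum_in_fin i (v : X i) : exists s : seq I, forall j, j \notin s ->
  dfwith (fun j => 0 : X j) v j = 0.
Proof.
exists [:: i] => j; rewrite inE => ij.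
by rewrite dfwith_out // eq_sym.
Qed.

Definition dsum_in_fun i (v : X i) : dsum_type := DSum (dsum_in_fin v).

Lemma dsum_inE i (v : X i) : dsum_in_fun v i = v.
Proof. exact: dfwith_in. Qed.

Lemma dsum_in_out i j (v : X i) : i != j -> dsum_in_fun v j = 0.
Proof. by move=> ij; apply: dfwith_out. Qed.

Opaque dsum_in_fun.

Lemma dsum_in_ext i (v : X i) (y : dsum_type) :
  y i = v -> (forall j, i != j -> y j = 0) -> dsum_in_fun v = y.
Proof.
move=> yi yj; apply: dsum_ext => j; case: (eqVneq i j) => [<-|ij].
  by rewrite dsum_inE.
by rewrite dsum_in_out // yj.
Qed.

Lemma dsum_in_linear i : linear (@dsum_in_fun i : X i -> dsum).
Proof.
move=> a v w; apply: dsum_in_ext => [|j ij] /=.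
  by rewrite !dsum_inE.
by rewrite !dsum_in_out // scaler0 addr0.
Qed.

Lemma dsum_in_gr i n (v : X i) :
  dsum_in_fun (pr (X i) n v) = pr dsum n (dsum_in_fun v).
Proof.
apply: dsum_in_ext => [|j ij] /=; first by rewrite dsum_inE.
by rewrite dsum_in_out // raddf0.
Qed.

Lemma dsum_in_d i (v : X i) :
  dsum_in_fun (d (X i) v) = d dsum (dsum_in_fun v).
Proof.
apply: dsum_in_ext => [|j ij] /=; first by rewrite dsum_inE.
by rewrite dsum_in_out // raddf0.
Qed.

Definition dsum_in i : dgHom (X i) dsum :=
  dgHom_of (@dsum_in_linear i) (@dsum_in_gr i) (@dsum_in_d i).

Definition dsum_supp (x : dsum_type) : seq I := undup (sval (cid (dsum_fin x))).

Lemma dsum_supp_uniq x : uniq (dsum_supp x).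
Proof. exact: undup_uniq. Qed.

Lemma dsum_suppP (x : dsum_type) i : i \notin dsum_supp x -> x i = 0.
Proof. by rewrite mem_undup; case: cid => s /= sx /sx. Qed.

Section Copair.
Variables (Y : dgMod A) (f : forall i, {linear X i -> Y}).

Definition dsum_copair_fun (x : dsum) : Y := \sum_(i <- dsum_supp x) f i (x i).

(** The chosen supports of x, y and x + y are unrelated; freedom in the support allows identities to
    be checked on a common one. *)
Lemma dsum_copairE (s : seq I) (x : dsum_type) : uniq s ->
  (forall i, i \notin s -> x i = 0) ->
  dsum_copair_fun x = \sum_(i <- s) f i (x i).
Proof.
have H (r : seq I) : \sum_(i <- r) f i (x i) =
    \sum_(i <- [seq i <- r | x i != 0]) f i (x i).
  rewrite big_filter [RHS]big_mkcond; apply: eq_bigr => i _ /=.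
  by case: eqP => //= ->; rewrite raddf0.
move=> us sx; rewrite /dsum_copair_fun H [RHS]H; apply: perm_big.
apply: uniq_perm; rewrite ?filter_uniq ?dsum_supp_uniq // => i.
rewrite !mem_filter; case: (eqVneq (x i) 0) => //= xi.
transitivity true; last apply/esym; apply: contraNT xi.
  by move/dsum_suppP ->.
by move/sx ->.
Qed.

Lemma dsum_copair_linear : linear dsum_copair_fun.
Proof.
move=> a x y; set s := undup (dsum_supp x ++ dsum_supp y).
have sx i : i \notin s -> x i = 0.
  by rewrite mem_undup mem_cat negb_or => /andP[/dsum_suppP].
have sy i : i \notin s -> y i = 0.
  by rewrite mem_undup mem_cat negb_or => /andP[_ /dsum_suppP].
have us : uniq s by apply: undup_uniq.
rewrite (dsum_copairE us sx) (dsum_copairE us sy) (@dsum_copairE s) //;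
  last first.
  by move=> i si /=; rewrite sx // sy // scaler0 addr0.
rewrite scaler_sumr -big_split; apply: eq_bigr => i _ /=.
by rewrite linearP.
Qed.

Lemma dsum_copair_in i (v : X i) : dsum_copair_fun (dsum_in i v) = f i v.
Proof.
rewrite (@dsum_copairE [:: i]) //; first by rewrite big_seq1 /= dsum_inE.
by move=> j; rewrite inE => ij; rewrite /= dsum_in_out // eq_sym.
Qed.

Lemma dsum_copair_comm (phi : forall i, X i -> X i)
  (phi0 : forall i, phi i 0 = 0)
    (psi : {additive Y -> Y}) (x : dsum) :
  (forall i v, f i (phi i v) = psi (f i v)) ->
  dsum_copair_fun (dsum_endo phi0 x) = psi (dsum_copair_fun x).
Proof.
move=> fphi; rewrite (@dsum_copairE (dsum_supp x)) ?dsum_supp_uniq //.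
  by rewrite raddf_sum; apply: eq_bigr => i _ /=; rewrite fphi.
by move=> i /dsum_suppP /= ->.
Qed.
End Copair.

Lemma dsum_copair_exists (Y : dgMod A) (f : forall i, dgHom (X i) Y) :
  exists g : dgHom dsum Y, forall i, dgcomp g (dsum_in i) =1 f i.
Proof.
have gl := dsum_copair_linear (fun i => f i).
have ggr n (x : dsum) : dsum_copair_fun (fun i => f i) (pr dsum n x)
    = pr Y n (dsum_copair_fun (fun i => f i) x).
  by apply: dsum_copair_comm => i v; apply: dgh_gr.
have gd (x : dsum) : dsum_copair_fun (fun i => f i) (d dsum x)
    = d Y (dsum_copair_fun (fun i => f i) x).
  by apply: dsum_copair_comm => i v; apply: dgh_d.
by exists (dgHom_of gl ggr gd) => i v; apply: dsum_copair_in.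
Qed.

Lemma dsum_sum_in (x : dsum) : x = \sum_(i <- dsum_supp x) dsum_in i (x i).
Proof.
apply: dsum_ext => j; rewrite dsum_sumE.
case sj: (j \in dsum_supp x).
  rewrite (bigD1_seq j) ?dsum_supp_uniq //= dsum_inE big1 ?addr0 // => i ij.
  exact: dsum_in_out.
rewrite dsum_suppP ?sj // big1_seq // => i /andP[_ si].
by apply: dsum_in_out; apply: contraFneq sj => <-.
Qed.

Lemma dsum_homotopic (Y : dgMod A) (f g : dgHom dsum Y) :
  (forall i, homotopic (dgcomp f (dsum_in i)) (dgcomp g (dsum_in i))) ->
  homotopic f g.
Proof.
move=> fg.
have /choice_dep[h hP] : forall i, exists h : {linear X i -> Y},
    (forall n x, h (pr (X i) n x) = pr Y (n - 1) (h x)) /\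
    forall x, f (dsum_in i x) - g (dsum_in i x) = d Y (h x) + h (d (X i) x).
  by move=> i; have [h hgr hd] := fg i; exists h.
apply: (@homotopicI _ _ dsum Y _ _ (dsum_copair_fun h)).
- exact: dsum_copair_linear.
- move=> n x; rewrite (@dsum_copairE Y h (dsum_supp x)) ?dsum_supp_uniq //.
    rewrite raddf_sum; apply: eq_bigr => i _ /=.
    by rewrite (hP i).1.
  by move=> i /dsum_suppP /= ->; rewrite raddf0.
- move=> x; rewrite (@dsum_copairE Y h (dsum_supp x) (d dsum x))
    ?dsum_supp_uniq //; last first.
    by move=> i /dsum_suppP /= ->; rewrite raddf0.
  rewrite {1 2}[x]dsum_sum_in (raddf_sum f) (raddf_sum g) (raddf_sum (dgm_d Y))
    -sumrB -big_split.
  by apply: eq_bigr => i _ /=; rewrite (hP i).2.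
Qed.
End DirectSum.
(* Otherwise [/=] exposes [dfwith]. *)
Opaque dsum_in_fun.

(** * Direct sums as coproducts in the derived category *)

Section Coproducts.
Variables (k : comPzRingType) (A : dgAlg k).
Local Notation dgMod := (dgMod A).
Local Notation pr X i := (dgm_gr X i).
Local Notation d X := (dgm_d X).
Implicit Types X Y Z W T N : dgMod.

Lemma dsum_map (I : eqType) (W X : I -> dgMod)
  (s : forall i, dgHom (W i) (X i)) :
  exists g : dgHom (dsum W) (dsum X), forall w i, g w i = s i (w i).
Proof.
have gfin (w : dsum W) : exists t : seq I, forall i, i \notin t -> s i (w i) =
  0.
  by have [t tw] := dsum_fin w; exists t => i /tw ->; rewrite raddf0.
have gl : linear ((fun w => DSum (gfin w)) : dsum W -> dsum X).
  by move=> a w v; apply: dsum_ext => i; apply: linearP.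
have ggr n (w : dsum W) : DSum (gfin (pr (dsum W) n w)) = pr (dsum X) n
  (DSum (gfin w)).
  by apply: dsum_ext => i; apply: dgh_gr.
have gd (w : dsum W) : DSum (gfin (d (dsum W) w)) = d (dsum X) (DSum (gfin w)).
  by apply: dsum_ext => i; apply: dgh_d.
by exists (dgHom_of gl ggr gd).
Qed.

Lemma dsum_cocycle (I : eqType) (X : I -> dgMod) n (x : dsum X) i :
  cocycle n x -> cocycle n (x i).
Proof. by case=> px dx; split;
  [rewrite -[in RHS]px | apply: (congr1 (dsum_eval i) dx)]. Qed.

Lemma dsum_cobound (I : eqType) (X : I -> dgMod) n (x : dsum X) :
  (forall i, cobound n (x i)) -> cobound n x.
Proof.
move=> bx.
(* The primitive is 0 wherever [x i] is 0, so that the chosen family has finite support. *)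
have /choice_dep[y yP] : forall i, exists y : X i,
    [/\ pr (X i) (n - 1) y = y, d (X i) y = x i & x i = 0 -> y = 0].
  move=> i; case: (eqVneq (x i) 0) => [xi0|xi0].
    by exists 0; rewrite !raddf0.
  by have [y py dy] := bx i; exists y; split=> // /eqP; rewrite (negPf xi0).
have yfin : exists t : seq I, forall i, i \notin t -> y i = 0.
  by have [t tx] := dsum_fin x; exists t => i /tx xi; have [_ _ ->] := yP i.
by exists (DSum yfin : dsum X); apply: dsum_ext => i; have [] := yP i.
Qed.

Lemma qiso_dsum (I : eqType) (W X : I -> dgMod)
  (s : forall i, dgHom (W i) (X i))
    (g : dgHom (dsum W) (dsum X)) :
  (forall w i, g w i = s i (w i)) -> (forall i, qiso (s i)) -> qiso g.
Proof.
move=> gE qs n; split=> [w cw [x px dx]|x cx].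
  apply: dsum_cobound => i; apply: (qs i n).1; first exact: dsum_cocycle.
  exists (x i); first exact: (congr1 (dsum_eval i) px).
  by apply: etrans (gE w i); apply: (congr1 (dsum_eval i) dx).
have /choice_dep[w wP] : forall i, exists w : W i,
    [/\ cocycle n w, cobound n (s i w - x i) & x i = 0 -> w = 0].
  move=> i; case: (eqVneq (x i) 0) => [xi0|xi0].
    exists 0; rewrite xi0 raddf0 subr0; split=> //; last exact: cobound0.
    exact/cobound_cocycle/cobound0.
  have [w cw bw] := (qs i n).2 _ (dsum_cocycle i cx).
  by exists w; split=> // /eqP; rewrite (negPf xi0).
have wfin : exists t : seq I, forall i, i \notin t -> w i = 0.
  by have [t tx] := dsum_fin x; exists t => i /tx xi; have [_ _ ->] := wP i.
exists (DSum wfin : dsum W).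
  by split; apply: dsum_ext => i; have [[]] := wP i.
apply: dsum_cobound => i; have [_ bw _] := wP i.
have -> // : (g (DSum wfin) - x : dsum X) i = s i (w i) - x i.
exact: (congr1 (fun z => z - x i) (gE (DSum wfin) i)).
Qed.

(** Direct sums of quasi-isomorphisms are quasi-isomorphisms: a family of roofs sums to a roof, and
    a family of equalising quasi-isomorphisms sums to one. *)
Lemma is_dsum_dsum (I : eqType) (X : I -> dgMod) : is_dsum X (dsum X).
Proof.
exists (fun i => dloc (dsum_in X i)) => Y u.
have [s sE] := dsum_map (fun i => dwit (u i)).
have qs := qiso_dsum sE (fun i => dwit_qiso (u i)).
have [f fE] := dsum_copair_exists (fun i => dleg (u i)).
set v := DHom qs f.
have vE i : deq (dcomp v (dloc (dsum_in X i))) (u i).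
  have H := @dcompE _ _ _ _ _ (dloc (dsum_in X i)) (DHom qs f) _ (dwit (u i))
    (dsum_in _ i) (dwit_qiso (u i)).
  apply: deq_trans (H _) _.
    apply: eq_homotopic => w; apply: dsum_in_ext => [|j ij]; rewrite /= sE /=.
      by rewrite dsum_inE.
    by rewrite dsum_in_out // raddf0.
  apply: deq_sym; apply: (@deq_refine _ _ _ _ _ _ _ _ (dgid _)).
    exact: eq_homotopic.
  by apply: eq_homotopic => w; rewrite -fE.
exists v; split=> // v' v'E.
(* For uniqueness, both maps become strict on [dsum X] after the same quasi-isomorphism [t' t], so
   that they can be compared on each summand. *)
have [Y1 [t [g [qt gE]]]] := left_roof v.
have [Y2 [t' [g' [qt' g'E]]]] := left_roof (dcomp (dloc t) v').
have tv : deq (dcomp (dloc (dgcomp t' t)) v) (dloc (dgcomp t' g)).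
  by rewrite -dloc_comp -dcompA gE dloc_comp.
have tv' : deq (dcomp (dloc (dgcomp t' t)) v') (dloc g').
  by rewrite -dloc_comp -dcompA g'E.
have qtt := qiso_comp qt' qt.
rewrite -(dcomp_idl v) -(dcomp_idl v') -(dinvl qtt) -!dcompA tv tv'.
suff -> : deq (dloc g') (dloc (dgcomp t' g)) by [].
have /choice_dep[W Ws] : forall i, exists Ws : {W : dgMod & dgHom W (X i)},
    qiso (projT2 Ws) /\
    homotopic (dgcomp (dgcomp g' (dsum_in X i)) (projT2 Ws))
              (dgcomp (dgcomp (dgcomp t' g) (dsum_in X i)) (projT2 Ws)).
  move=> i; have /dloc_eqP[W [s' [qs' gs]]] : deq
    (dloc (dgcomp g' (dsum_in X i)))
      (dloc (dgcomp (dgcomp t' g) (dsum_in X i))).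
    by rewrite -2!dloc_comp -tv -tv' -!dcompA v'E vE.
  by exists (existT _ W s').
have [r rE] := dsum_map (fun i => projT2 (W i)).
apply/dloc_eqP; exists (dsum (fun i => projT1 (W i))), r; split.
  by apply: qiso_dsum rE _ => i; have [] := Ws i.
apply: dsum_homotopic => i; have [_ gs] := Ws i.
have rin (w : projT1 (W i)) : r (dsum_in _ i w) = dsum_in X i (projT2 (W i) w).
  apply: esym; apply: dsum_in_ext => [|j ij]; rewrite rE /=.
    by rewrite dsum_inE.
  by rewrite dsum_in_out // raddf0.
by apply: eq_homotopicW gs _ _ => w /=; rewrite -[r _]/(r (dsum_in _ i w)) rin.
Qed.

End Coproducts.

(** * Formal properties of coproducts and direct summands *)

Section CoproductTheory.
Variables (k : comPzRingType) (A : dgAlg k).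
Local Notation dgMod := (dgMod A).
Local Notation pr X i := (dgm_gr X i).
Local Notation d X := (dgm_d X).
Implicit Types X Y Z W T N : dgMod.

Lemma is_dsum_exists (I : Type) (X : I -> dgMod) : exists S, is_dsum X S.
Proof. by exists (dsum (X : {classic I} -> dgMod));
  apply: (@is_dsum_dsum _ _ {classic I}). Qed.

Lemma is_dsum_uniq (I : Type) (X : I -> dgMod) S S' :
  is_dsum X S -> is_dsum X S' -> qeq S S'.
Proof.
move=> [e eU] [e' eU']; have [v [ve _]] := eU _ e';
  have [v' [ve' _]] := eU' _ e.
apply/qeqP; exists v, v'; split.
  have [w [_ wU]] := eU _ e.
  rewrite (wU (dcomp v' v)); last by move=> i; rewrite -dcompA ve ve'.
  by rewrite -(wU (did S)) // => i; rewrite dcomp_idl.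
have [w [_ wU]] := eU' _ e'.
rewrite (wU (dcomp v v')); last by move=> i; rewrite -dcompA ve' ve.
by rewrite -(wU (did S')) // => i; rewrite dcomp_idl.
Qed.

Lemma is_dsum_qeq (I : Type) (X : I -> dgMod) S S' :
  qeq S S' -> is_dsum X S -> is_dsum X S'.
Proof.
move=> /qeqP[a /diso_inv[b [_ ba ab]]] [e eU].
exists (fun i => dcomp a (e i)) => Y u; have [v [ve vU]] := eU Y u.
exists (dcomp v b); split=> [i|v' v'E].
  by rewrite dcompA -(dcompA a) ba dcomp_idr.
rewrite -(vU (dcomp v' a)) => [|i]; last by rewrite -dcompA.
by rewrite -dcompA ab dcomp_idr.
Qed.

Lemma is_dsum_comp (I : Type) (X X' : I -> dgMod) S :
  (forall i, qeq (X i) (X' i)) -> is_dsum X S -> is_dsum X' S.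
Proof.
move=> XX [e eU].
have /choice_dep[a aP] : forall i, exists a : dHom (X i) (X' i), diso a.
  by move=> i; apply/qeqP.
have /choice_dep[b bP] : forall i, exists b : dHom (X' i) (X i),
    deq (dcomp b (a i)) (did (X i)) /\ deq (dcomp (a i) b) (did (X' i)).
  by move=> i; have [b] := aP i; exists b.
exists (fun i => dcomp (e i) (b i)) => Y u.
have [v [ve vU]] := eU Y (fun i => dcomp (u i) (a i)).
exists v; split=> [i|v' v'E].
  by rewrite dcompA ve -dcompA (bP i).2 dcomp_idr.
apply: vU => i; rewrite -(v'E i) dcompA -(dcompA (a i)) (bP i).1.
by rewrite dcomp_idr.
Qed.

Lemma is_dsum_sigma (I : Type) (J : I -> Type) (X : forall i, J i -> dgMod)
    (T : I -> dgMod) S :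
  (forall i, is_dsum (X i) (T i)) -> is_dsum T S ->
  is_dsum (fun p : {i : I & J i} => X (projT1 p) (projT2 p)) S.
Proof.
move=> TU [e eU]; have /choice_dep[f fU] := TU.
exists (fun p => dcomp (e (projT1 p)) (f (projT1 p) (projT2 p))) => Y u.
have /choice_dep[v vP] i := fU i Y (fun j => u (existT J i j)).
have [w [we wU]] := eU Y v; exists w; split=> [[i j] /=|w' w'E].
  by rewrite dcompA we (vP i).1.
apply: wU => i; apply: (vP i).2 => j.
by rewrite -dcompA (w'E (existT J i j)).
Qed.

Lemma is_dsum_reindex (I J : Type) (X : I -> dgMod) S (f : J -> I)
    (g : I -> J) :
  cancel f g -> cancel g f -> is_dsum X S -> is_dsum (X \o f) S.
Proof.
move=> fK gK [e eU]; exists (fun j => e (f j)) => Y u.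
(* The member of the family at [g i] has source [X (f (g i))]; it is transported to [X i] along
   [gK i]. *)
have /choice_dep[u' u'E] : forall i, exists u' : dHom (X i) Y,
    forall j (ij : f j = i), deq u' (ecast i (dHom (X i) Y) ij (u j)).
  move=> i; exists (ecast i (dHom (X i) Y) (gK i) (u (g i))) => j ij.
  case: _ / ij; move: (gK (f j)); rewrite fK => E.
  by rewrite (Prop_irrelevance E erefl).
have [v [ve vU]] := eU Y u'; exists v; split=> [j|v' v'E].
  by rewrite ve (u'E (f j) j erefl).
apply: vU => i; rewrite -(gK i) (u'E _ (g i) erefl) /=.
exact: v'E.
Qed.

Lemma is_dsum_prod X Y :
  is_dsum (fun b : bool => if b then X else Y) (prodm X Y).
Proof.
set Z := fun b : bool => if b then X else Y.
apply: is_dsum_qeq (@is_dsum_dsum _ _ bool Z).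
pose G (p : prodm X Y) b : Z b := match b with true => p.1 | false => p.2 end.
have Gfin p : exists s : seq bool, forall b, b \notin s -> G p b = 0.
  by exists [:: true; false] => -[].
pose g p : dsum Z := @DSum _ _ bool Z (G p) (Gfin p).
apply: (@qeq_bij _ _ (dsum Z) (prodm X Y) (fun x => (x true, x false)) g) => //.
  by move=> x; apply: dsum_ext => -[].
by case.
Qed.

Lemma summandP X S : summand X S <-> exists Y, qeq S (prodm X Y).
Proof.
split=> [[Y XY] | [Y XY]]; exists Y.
  exact: is_dsum_uniq XY (is_dsum_prod X Y).
by apply: is_dsum_qeq (qeq_sym XY) (is_dsum_prod X Y).
Qed.

Lemma summand_trans X S T : summand X S -> summand S T -> summand X T.
Proof.
move=> /summandP[Y SY] /summandP[Z TZ]; apply/summandP; exists (prodm Y Z).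
apply: qeq_trans TZ (qeq_trans _ (qeq_prodA X Y Z)).
exact: qeq_prod SY (qeq_refl Z).
Qed.

Lemma summand_qeq X X' S S' : qeq X X' -> qeq S S' -> summand X S ->
  summand X' S'.
Proof.
move=> XX SS /summandP[Y SY]; apply/summandP; exists Y.
apply: qeq_trans (qeq_sym SS) (qeq_trans SY _).
exact: qeq_prod XX (qeq_refl Y).
Qed.

Lemma summand_prodl X Y : summand X (prodm X Y).
Proof. by exists Y; apply: is_dsum_prod. Qed.

Lemma summand_prodr X Y : summand Y (prodm X Y).
Proof. by apply/summandP; exists X; apply: qeq_prodC. Qed.

Lemma summand_refl X : summand X X.
Proof.
(* The acyclic cone of the identity serves as zero complement. *)
apply/summandP; exists (cone (dgid X));
  apply: (@qiso_qeq _ _ _ _ (prod_in1 _ _)).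
have aC := qiso_acyclic (@qiso_id _ A X).
move=> i; split=> [x cx /prod_cobound[]//|[x y] /prod_cocycle[cx /aC by_]].
exists x => //; apply/prod_cobound; rewrite /= subrr; split;
  first exact: cobound0.
by rewrite add0r; apply: coboundN.
Qed.

Lemma is_dsum1 X : is_dsum (fun _ : unit => X) X.
Proof.
exists (fun=> did X) => Y u; exists (u tt); split=> [[]|v vE].
  exact: dcomp_idr.
by rewrite -(vE tt) dcomp_idr.
Qed.

Lemma is_dsum_prod_sum (I J : Type) (X : dgMod) S T :
  is_dsum (fun _ : I => X) S -> is_dsum (fun _ : J => X) T ->
  exists K : Type, is_dsum (fun _ : K => X) (prodm S T).
Proof.
move=> SX TX; exists {b : bool & if b then I else J}.
by apply: is_dsum_sigma (is_dsum_prod S T) => -[].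
Qed.

(** Both sides are coproducts over I and two labels, taken in the two orders. *)
Lemma is_dsum_pairs (I : Type) X Y S T R :
  is_dsum (fun _ : I => X) S -> is_dsum (fun _ : I => Y) T ->
  is_dsum (fun _ : I => prodm X Y) R -> qeq R (prodm S T).
Proof.
move=> SX TY RXY.
have H1 := is_dsum_sigma (fun=> is_dsum_prod X Y) RXY.
have H2 : is_dsum (fun p : {_ : bool & I} => if projT1 p then X else Y)
  (prodm S T).
  apply: (@is_dsum_sigma bool (fun=> I) (fun b _ => if b then X else Y)
    (fun b => if b then S else T)); last exact: is_dsum_prod.
  by case.
apply: is_dsum_uniq H1 _.
pose f (I J : Type) (p : {_ : I & J}) : {_ : J & I} := existT _ (projT2 p)
  (projT1 p).
by apply: (is_dsum_reindex (f := @f I bool) (g := @f bool I)) H2 => -[].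
Qed.
End CoproductTheory.

(** * Approximations by Add(U) *)

Section Approximation.
Variables (k : comPzRingType) (A : dgAlg k).
Local Notation dgMod := (dgMod A).
Local Notation pr X i := (dgm_gr X i).
Local Notation d X := (dgm_d X).
Implicit Types X Y Z W T N : dgMod.

Lemma diso_id X : diso (did X).
Proof. by exists (did X); split; apply: dcomp_idl. Qed.

Lemma acyclic_zero X : acyclic X -> is_zero X.
Proof.
move=> aX; apply/dloc_eqP; exists X, (dgzero X X); split;
  last exact: eq_homotopic.
by move=> i; split=> [x /aX//|y /aX by_]; exists 0; rewrite ?sub0r;
  [apply/cobound_cocycle/cobound0 | apply: coboundN].
Qed.

Lemma zero_acyclic X : is_zero X -> acyclic X.
Proof.
case/dloc_eqP=> W [s [qs s0]] i x cx; have [w cw bw] := (qs i).2 x cx.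
rewrite -(subKr (s w) x); apply: coboundB => //.
by have := homotopic_cobound s0 cw; rewrite /= subr0.
Qed.

Lemma hz_zerol X T : is_zero X -> hz X T.
Proof.
move=> X0 u; have E : deq (did X) (dzero X X) := X0.
by rewrite -(dcomp_idr u) E dcomp0.
Qed.

Lemma hz_zeror X T : is_zero X -> hz T X.
Proof.
move=> X0 u; have E : deq (did X) (dzero X X) := X0.
by rewrite -(dcomp_idl u) E dcomp0l. Qed.

Lemma zero_shift n X : is_zero X -> is_zero (shift n X).
Proof. by move=> /zero_acyclic/(acyclic_shift (n := n));
  apply: acyclic_zero. Qed.

Lemma diso_qeq X Y (u : dHom X Y) : diso u -> qeq X Y.
Proof. by move=> du; apply/qeqP; exists u. Qed.

(** Reduces closure under triangles to closure under isomorphism and under cones of strict maps. *)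
Lemma triangleP X Y Z : triangle X Y Z ->
  exists X' Y' (f : dgHom X' Y'), [/\ qeq X X', qeq Y Y' & qeq Z (cone f)].
Proof.
case=> u [v [w [X' [Y' [f [a [b
  [c [[/diso_qeq qa /diso_qeq qb /diso_qeq qc] _]]]]]]]]].
by exists X', Y', f.
Qed.

Lemma triangle_cone X Y (f : dgHom X Y) : triangle X Y (cone f).
Proof.
exists (dloc f), (dloc (cone_in f)), (dloc (cone_out f)), X, Y, f.
exists (did X), (did Y), (did (cone f)); split; first by split; apply: diso_id.
have shift_did : deq (dshift 1 (did X)) (did (shift 1 X)).
  by apply: deq_roof; apply: eq_homotopic.
by split; rewrite ?shift_did dcomp_idl dcomp_idr.
Qed.

Lemma hz_dsum (I : Type) (X : I -> dgMod) S T :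
  is_dsum X S -> (forall i, hz (X i) T) -> hz S T.
Proof.
move=> [e eU] XT u; have [v [_ vU]] := eU T (fun i => dzero (X i) T).
rewrite (vU u) => [|i]; last exact: XT.
by rewrite -(vU (dzero S T)) // => i; rewrite dcomp0l.
Qed.

Lemma hz_summandl X S T : summand X S -> hz S T -> hz X T.
Proof.
move=> /summandP[Y SY] ST; apply: (hz_retractl (@prod_in1K _ _ X Y)).
exact: hz_qeq SY (qeq_refl T) ST.
Qed.

Lemma hz_summandr X S T : summand X S -> hz T S -> hz T X.
Proof.
move=> /summandP[Y SY] ST; apply: (hz_retractr (@prod_in1K _ _ X Y)).
exact: hz_qeq (qeq_refl T) SY ST.
Qed.

Lemma summand_shift n X S : summand X S -> summand (shift n X) (shift n S).
Proof.
move=> /summandP[Y SY]; apply/summandP; exists (shift n Y).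
exact: qeq_trans (qeq_shift n SY) (qeq_shift_prod n X Y).
Qed.

Lemma hz_shift_shift T X m n p : p = m + n ->
  hz T (shift p X) -> hz T (shift n (shift m X)).
Proof.
by move=> ->; apply: hz_qeq (qeq_refl T) (qeq_sym (qeq_shiftD m n X)).
Qed.

Lemma hz_shiftl X Z m i : hz X (shift (i - m) Z) -> hz (shift m X) (shift i Z).
Proof.
move=> /(hz_shift (n := m)); apply: hz_qeq (qeq_refl _) _.
by have := qeq_shiftD (i - m) m Z; rewrite subrK.
Qed.

Lemma hz_shift_cone T X Y (f : dgHom X Y) i :
  hz T (cone (shift_hom i f)) -> hz T (shift i (cone f)).
Proof. by apply: hz_qeq (qeq_refl T) (qeq_sym (qeq_shift_cone i f)). Qed.

Lemma cohom0_qeq X Y i : qeq X Y -> cohom0 X i -> cohom0 Y i.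
Proof.
case=> W [s [t [qs qt]]] X0 y cy; have [w cw bw] := (qt i).2 y cy.
rewrite -(subKr (t w) y); apply: coboundB => //; apply: dgh_cobound.
by apply: (qs i).1 => //; apply: X0; apply: dgh_cocycle.
Qed.

Lemma hproj_dsum (I : eqType) (X : I -> dgMod) :
  (forall i, hproj (X i)) -> hproj (dsum X).
Proof.
move=> pX N aN g; apply: dsum_homotopic => i.
exact: eq_homotopicW (pX i N aN (dgcomp g (dsum_in X i))) _ _.
Qed.

Lemma is_dsum_model (I : Type) (X : I -> dgMod) S :
  is_dsum X S -> qeq S (dsum (X : {classic I} -> dgMod)).
Proof.
by move=> SX; apply: is_dsum_uniq SX (@is_dsum_dsum _ _ {classic I} X).
Qed.

Lemma Add_self X : Add X X.
Proof. by exists unit, X; split; [apply: is_dsum1 | apply: summand_refl]. Qed.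

Lemma Add_summand U X Y : summand X Y -> Add U Y -> Add U X.
Proof.
move=> XY [I [S [SU YS]]]; exists I, S; split=> //.
exact: summand_trans XY YS.
Qed.

Lemma Add_qeq U X Y : qeq X Y -> Add U X -> Add U Y.
Proof.
move=> XY; apply: Add_summand.
exact: summand_qeq XY (qeq_refl X) (summand_refl X).
Qed.

(** Every coproduct of copies of U is isomorphic to the explicit direct sum, whose coboundaries are
    found coordinatewise. *)
Lemma Add_D_le0 U X : D_le0 U -> Add U X -> D_le0 X.
Proof.
move=> U0 [I [S [SU /summandP[Y XY]]]] i i0.
have H : cohom0 (prodm X Y) i.
  apply: cohom0_qeq (qeq_trans (qeq_sym (is_dsum_model SU)) XY) _ => y cy.
  by apply: dsum_cobound => j; apply: U0 => //; apply: dsum_cocycle.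
move=> x cx; have /H/prod_cobound[//] : @cocycle k A (prodm X Y) i (x, 0).
by apply/prod_cocycle; split=> //; apply/cobound_cocycle/cobound0.
Qed.

(** Allowing summands makes closure under summands immediate, without splitting idempotents; maps
    out of X remain controlled by strict maps out of S through the retraction. *)
Definition hproj_summand X := exists2 S, hproj S & summand X S.

Lemma thick_hproj_summand : thick_subcat hproj_summand.
Proof.
split.
(* Adding an acyclic X to A does not change its isomorphism class, so X is a summand of A. *)
- move=> X /zero_acyclic aX; exists (regular A); first exact: hproj_regular.
  apply/summandP; exists (regular A).
  apply: qeq_trans (qeq_prodC _ _); apply: (@qiso_qeq _ _ _ _ (prod_in1 _ _)).
  move=> i; split=> [x cx /prod_cobound[]//|[x y] /prod_cocycle[cx /aX by_]].
  exists x => //; apply/prod_cobound; rewrite /= subrr; split;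
    first exact: cobound0.
  by rewrite add0r; apply: coboundN.
- move=> X Y u /diso_qeq XY [S pS XS]; exists S => //.
  exact: summand_qeq XY (qeq_refl S) XS.
- move=> n X [S pS XS]; exists (shift n S); first exact: hproj_shift.
  exact: summand_shift.
- move=> X Y Z /triangleP[X' [Y' [f [XX YY ZC]]]].
  move=> [S pS /(summand_qeq XX (qeq_refl S))/summandP[P /qeqP[a da]]].
  move=> [T pT /(summand_qeq YY (qeq_refl T))/summandP[Q /qeqP[b db]]].
  have [b' [_ b'b bb']] := diso_inv db.
  (* Extended by zero, [f] becomes a morphism from S to T in the derived category. As S is
     homotopically projective it is represented by a strict [g], whose cone has the cone of [f] as a
     summand. *)
  pose F := prod_pair (dgcomp f (prod_fst X' P)) (dgzero (prodm X' P) Q).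
  have [g gE] := hproj_roof (dcomp b' (dcomp (dloc F) a)) pS.
  exists (cone g); first exact: hproj_cone.
  apply: summand_qeq (qeq_sym ZC) _ (summand_prodl _ (prodm (shift 1 P) Q)).
  apply: qeq_trans (qeq_sym (qeq_cone_prod P Q f)) (qeq_sym _).
  apply: qeq_cone da db _.
  by rewrite -gE dcompA bb' dcomp_idl.
- by move=> X S XS [T pT ST]; exists T => //; apply: summand_trans XS ST.
Qed.

Lemma Add_regular_hproj X : Add (regular A) X -> hproj_summand X.
Proof.
move=> [I [S [/is_dsum_model SU XS]]].
exists (dsum (fun _ : {classic I} => regular A)).
  by apply: hproj_dsum => _; apply: hproj_regular.
exact: summand_qeq (qeq_refl X) SU XS.
Qed.

Lemma summand_retract X S : summand X S ->
  exists (i : dHom X S) (r : dHom S X), deq (dcomp r i) (did X).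
Proof.
move=> [Y [e eU]].
have [r [rE _]] := eU X (fun b => match b return dHom (if b then X else Y) X
  with
  true => did X | false => dzero Y X end).
by exists (e true), r; apply: (rE true).
Qed.

(* The copies of [U] are indexed by the maps from a homotopically projective
   module having [U] as a direct summand, which form a small type, unlike the
   roofs themselves. *)
Lemma Add_approx U Y : hproj_summand U ->
  exists C (p : dgHom C Y), Add U C /\
    forall u : dHom U Y, exists v, deq u (dcomp (dloc p) v).
Proof.
move=> [S pS /summand_retract[i [r ri]]].
have [C [e eU]] := is_dsum_exists (fun _ : dgHom S Y => U).
have [p [pE _]] := eU Y (fun g => dcomp (dloc g) i).
(* The map out of the coproduct is a roof; its apex is isomorphic to the coproduct and carries a
   strict map to Y. *)
exists (apex p), (dleg p); split.
  apply: (Add_qeq (qeq_sym (qiso_qeq (dwit_qiso p)))).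
  by exists (dgHom S Y), C; split; [exists e | apply: summand_refl].
move=> u; have [g gE] := hproj_roof (dcomp u r) pS.
exists (dcomp (dinv (dwit_qiso p)) (e g)).
rewrite -dcomp_wit -dcompA (dcompA _ _ (dloc _)) dinvr dcomp_idl pE -gE.
by rewrite -dcompA ri dcomp_idr.
Qed.
End Approximation.

(** * Finite coresolutions *)

Section Coresolutions.
Variables (k : comPzRingType) (A : dgAlg k).
Local Notation dgMod := (dgMod A).
Local Notation pr X i := (dgm_gr X i).
Local Notation d X := (dgm_d X).
Implicit Types X Y Z W T N : dgMod.

(** Once Y -> cone f vanishes, the rotated triangle starts with a zero map, so its cone X[1]
    splits. *)
Lemma hz_cone_in0 X Y (f : dgHom X Y) :
  hz Y (cone f) -> qeq (shift 1 X) (prodm (shift 1 Y) (cone f)).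
Proof.
move=> /(_ (dloc (cone_in f))) i0.
apply: qeq_trans (qeq_sym (qeq_cone_in f)) (qeq_trans _ (qeq_cone0 Y (cone f))).
apply: (qeq_cone (diso_id Y) (diso_id (cone f))).
by rewrite dcomp_idl dcomp_idr i0.
Qed.

Section Coresolution.
Variable U : dgMod.

(** Strict maps and cones in place of triangles, ending in an object of Add(U), so that [octahedral]
    applies directly in inductions. *)
Fixpoint Add_cores (n : nat) X : Prop :=
  if n is n'.+1 then
    exists C (f : dgHom X C), Add U C /\ Add_cores n' (cone f)
  else Add U X.

Lemma Add_cores_qeq n X Y : qeq X Y -> Add_cores n X -> Add_cores n Y.
Proof.
elim: n X Y => [|n IH] X Y; first exact: Add_qeq.
move=> /qeq_sym/qeqP[a da] [C [f [UC fn]]].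
have [C' [t [g [qt gE]]]] := left_roof (dcomp (dloc f) a).
exists C', g; split; first exact: Add_qeq (qiso_qeq qt) UC.
apply: IH fn; apply: qeq_sym; apply: (@qeq_cone _ _ _ _ _ _ g f a (dinv qt)) =>
  //.
  by exists (dloc t); split; [apply: dinvr | apply: dinvl].
by rewrite -gE dcompA dinvl dcomp_idl.
Qed.

(** The octahedron for X -> Y -> C passes the extra term down the coresolution of Y. Each stage
    shifts it by one, so it starts as D[-n] and enters unshifted at the end. *)
Lemma Add_cores_ext n X Y (f : dgHom X Y) D :
  qeq (cone f) (shift (- n%:Z) D) -> Add U D -> Add_cores n Y ->
  Add_cores n.+1 X.
Proof.
elim: n X Y f => [|n IH] X Y f fD UD.
  move=> UY; exists Y, f; split=> //=; apply: Add_qeq UD; apply: qeq_sym.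
  by apply: qeq_trans fD _; rewrite oppr0; apply: qeq_shift0.
move=> [C [g [UC gn]]]; exists C, (dgcomp g f); split=> //.
have [phi phiE] := octahedral f g; apply: (IH _ _ phi) UD gn.
apply: qeq_trans phiE (qeq_trans (qeq_shift 1 fD) _).
have := qeq_shiftD (- n.+1%:Z) 1 D.
by have -> : - n.+1%:Z + 1 = - n%:Z by lia.
Qed.

Lemma Add_cores_codim n X : Add_cores n X -> codim_le (Add U) X n.
Proof.
elim: n X => [|n IH] X.
  (* The zero object closing the sequence is the cone of the identity. *)
  move=> UX; exists (fun i => if i is 0%N then X else cone (dgid X)), (fun=> X).
  split=> //; first exact/acyclic_zero/qiso_acyclic/qiso_id.
  by case=> // _; split=> //; apply: triangle_cone.
move=> [C [f [UC /IH[Xs [Cs [Xs0 Xsn XsE]]]]]].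
exists (fun i => if i is i'.+1 then Xs i' else X).
exists (fun i => if i is i'.+1 then Cs i' else C); split=> // -[_|i /XsE //].
by split=> //; rewrite Xs0; apply: triangle_cone.
Qed.
End Coresolution.

(** * Vanishing of Hom into the perpendicular class of U *)

Section Silting.
Variable U : dgMod.
Hypotheses (U_perp : forall X, Add U X -> perp_gt0 U X)
  (U_hproj : hproj_summand U).

Lemma hz_Add C Z i : Add U C -> perp_gt0 U Z -> (0 < i)%R -> hz C (shift i Z).
Proof.
move=> [I [S [SU CS]]] UZ i0; apply: hz_summandl CS (hz_dsum SU _) => _.
exact: UZ.
Qed.

Lemma perp_approx Y : exists C (p : dgHom C Y), Add U C /\
  (perp_gt0 U Y -> perp_gt0 U (shift (- 1) (cone p))).
Proof.
have [C [p [UC pE]]] := Add_approx Y U_hproj; exists C, p; split=> // UY i i0.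
have UC1 := U_perp UC.
suff H : hz U (shift (i - 1) (cone p)).
  by apply: hz_shift_shift H; rewrite addrC.
(* For i = 1 vanishing expresses that maps U -> Y factor through [p]; for i > 1 it is exactness
   between Y[i - 1] and C[i]. *)
case: (eqVneq i 1) => [->|i1].
  rewrite subrr; apply: hz_qeq (qeq_refl U) (qeq_sym (qeq_shift0 (cone p))) _
    => u.
  have [|v ->] := @lift_cone_out _ _ _ _ _ p u; first exact: UC1.
  have [w ->] := pE v.
  rewrite dcompA dloc_comp (dloc_homotopic (cone_in_comp p)).
  exact: dcomp0l.
apply: hz_shift_cone; apply: hz_cone_right; first by apply: UY; lia.
by apply: hz_shift_shift (UC1 i _) => //; rewrite subrK.
Qed.

Definition perp_bound X :=
  (exists m : int, forall i, (m < i)%R -> hz U (shift i X)) /\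
  (exists n : int, forall Z, perp_gt0 U Z ->
     forall i, (n < i)%R -> hz X (shift i Z)).

Lemma thick_perp_bound : thick_subcat perp_bound.
Proof.
split.
- move=> X X0; split; last by exists 0 => Z _ i _; apply: hz_zerol.
  by exists 0 => i _; apply: hz_zeror; apply: zero_shift.
- move=> X Y u /diso_qeq XY [[m mX] [n nX]]; split.
    exists m => i /mX; apply: hz_qeq (qeq_refl U) (qeq_shift i XY).
  by exists n => Z UZ i /(nX Z UZ); apply: hz_qeq XY (qeq_refl _).
- move=> s X [[m mX] [n nX]]; split.
    by exists (m - s) => i im; apply: hz_shift_shift (mX (s + i) _) => //; lia.
  by exists (n + s) => Z UZ i im; apply: hz_shiftl; apply: nX => //; lia.
- move=> X Y Z /triangleP[X' [Y' [f [XX YY ZC]]]].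
  move=> [[m mX] [n nX]] [[m' mY] [n' nY]]; split.
    (* A crude bound above both m and m', whatever their signs. *)
    exists (`|m| + `|m'|) => i im.
    apply: hz_qeq (qeq_refl U) (qeq_shift i (qeq_sym ZC)) _.
    apply: hz_shift_cone; apply: hz_cone_right.
      by apply: hz_qeq (qeq_refl U) (qeq_shift i YY) (mY i _); lia.
    apply: hz_shift_shift (erefl _) _.
    by apply: hz_qeq (qeq_refl U) (qeq_shift _ XX) (mX (i + 1) _); lia.
  (* The extra 1 pays for Hom(X[1], T[i]) = Hom(X, T[i - 1]). *)
  exists (`|n| + `|n'| + 1) => T UT i im.
  apply: hz_qeq (qeq_sym ZC) (qeq_refl _) _; apply: hz_cone_left.
    by apply: hz_qeq YY (qeq_refl _) (nY T UT i _); lia.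
  by apply: hz_shiftl; apply: hz_qeq XX (qeq_refl _) (nX T UT _ _); lia.
- move=> X S XS [[m mS] [n nS]]; split.
    by exists m => i im; apply: hz_summandr (summand_shift i XS) (mS i im).
  by exists n => Z UZ i im; apply: hz_summandl XS (nS Z UZ i im).
Qed.

Lemma Add_perp_bound X : Add U X -> perp_bound X.
Proof.
move=> UX; split; last by exists 0 => Z UZ i i0; apply: hz_Add.
by exists 0 => i i0; apply: U_perp.
Qed.

(* Dimension shifting: by connectivity of [C], a map from [A] to [Z[i]] survives
   in [A -> N[i]], where [N] is the cone of an approximation [C -> Z]. *)
Lemma hz_regular_perp : D_le0 U -> perp_bound (regular A) ->
  forall Z, perp_gt0 U Z -> forall i : int, (0 < i)%R ->
  hz (regular A) (shift i Z).
Proof.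
move=> U0 [_ [n nA]] Z UZ i i0.
(* [r] bounds the distance to the range i > n; one step replaces Z by a cocone and i by i + 1. *)
have [r] : exists r : nat, (n < i + r%:Z)%R by exists `|n|%N; lia.
elim: r Z UZ i i0 => [|r IH] Z UZ i i0 ir; first by apply: nA => //; lia.
have [C [p [UC /(_ UZ) UN]]] := perp_approx Z.
apply: (hz_cone_middle (f := shift_hom i p)).
  by apply/hz_regular/cohom0_shift; rewrite add0r; apply: Add_D_le0 UC _ _.
apply: hz_qeq (qeq_refl _) (qeq_shift_cone i p) _.
have H : hz (regular A) (shift (i + 1) (shift (- 1) (cone p))).
  by apply: IH => //; lia.
apply: hz_qeq (qeq_refl _) _ H.
by have := qeq_shiftD (-1) (i + 1) (cone p); rewrite addrCA addNr addr0.
Qed.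

(** Let K be the cocone of an approximation C -> Y. For r = 0, Hom(Y, K[1]) = 0 splits the
    approximation and Y is a summand of C. For r + 1, K satisfies the hypotheses with r, and
    [Add_cores_ext] applies to Y[-r-1] -> K[-r] -> C[-r]. *)
Lemma perp_Add_cores (r : nat) Y : perp_gt0 U Y ->
  (forall Z, perp_gt0 U Z -> forall i : int, (r%:Z < i)%R ->
     hz Y (shift i Z)) ->
  Add_cores U r (shift (- r%:Z) Y).
Proof.
elim: r Y => [|r IH] Y UY Yr; have [C [p [UC /(_ UY) UN]]] := perp_approx Y.
  have qN : qeq (shift 1 (shift (- 1) (cone p))) (cone p).
    by apply: qeq_shiftK.
  have YN : hz Y (cone p) by apply: hz_qeq (qeq_refl _) qN (Yr _ UN 1 _).
  apply: Add_qeq (Add_summand _ UC).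
    by rewrite oppr0; apply: qeq_sym; apply: qeq_shift0.
  apply/summandP; exists (shift (- 1) (cone p));
    apply: (qeq_shift_inj (n := 1)).
  apply: qeq_trans (hz_cone_in0 YN)
    (qeq_sym (qeq_trans (qeq_shift_prod _ _ _) _)).
  exact: qeq_prod (qeq_refl _) qN.
pose K := shift (- 1) (cone p).
have KE : Add_cores U r (shift (- r.+1%:Z) (cone p)).
  apply: Add_cores_qeq (IH K UN _) => [|Z UZ i ir].
    by have := qeq_shiftD (- 1) (- r%:Z) (cone p); rewrite -opprD.
  apply: hz_shiftl; apply: hz_cone_left; first by apply: Yr => //; lia.
  by apply: hz_shiftl; apply: hz_Add => //; lia.
apply: (Add_cores_ext (f := shift_hom (- r.+1%:Z) (cone_in p))) UC KE.
apply: qeq_trans (qeq_sym (qeq_shift_cone _ _)) _.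
apply: qeq_trans (qeq_shift _ (qeq_cone_in p)) _.
by have := qeq_shiftD 1 (- r.+1%:Z) C; have -> : 1 - r.+1%:Z = - r%:Z by lia.
Qed.

Lemma regular_Add_cores : D_le0 U -> perp_bound (regular A) ->
  exists n, Add_cores U n (regular A).
Proof.
move=> U0 bA; have [[m mA] _] := bA.
(* The shift serves twice: A[|m|] lies in P, and Hom(A[|m|], Z[i]) = Hom(A, Z[i - |m|]) vanishes for
   i > |m|. *)
exists `|m|%N; apply: Add_cores_qeq
  (perp_Add_cores (Y := shift `|m| (regular A)) _ _).
- by apply: qeq_shiftK; rewrite subrr.
- by move=> i i0; apply: hz_shift_shift (mA (`|m| + i) _) => //; lia.
- move=> Z UZ i im; apply: hz_shiftl; apply: hz_regular_perp => //; lia.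
Qed.
End Silting.

(** * Absorbing finitely many terms in one coproduct of copies of U *)

Lemma fin_add_summand U X : summand X U -> fin_add U X.
Proof.
move=> XU; exists 1%N, U; split=> //.
apply: (is_dsum_reindex (f := fun _ : 'I_1 => tt) (g := fun=> ord0))
  (is_dsum1 U).
  by move=> i; apply/val_inj; case: i => -[].
by case.
Qed.

Lemma Add_common_dsum U (C : nat -> dgMod) (n : nat) :
  (forall i, (i <= n)%N -> Add U (C i)) ->
  exists (J : Type) (V : dgMod), [/\ is_dsum (fun _ : J => U) V, summand U V &
    forall i, (i <= n)%N -> summand (C i) V].
Proof.
elim: n => [|n IH] UC.
  have [I [S [SU CS]]] := UC 0%N isT.
  (* U itself is put into V, so that Add(V) contains Add(U). *)
  have [K UK] := is_dsum_prod_sum (is_dsum1 U) SU.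
  exists K, (prodm U S); split=> [//||i]; first exact: summand_prodl.
  by rewrite leqn0 => /eqP ->; apply: summand_trans CS (summand_prodr _ _).
have [|J [V [VU UV CV]]] := IH; first by move=> i /leqW/UC.
have [I [S [SU CS]]] := UC n.+1 (leqnn _).
have [K UK] := is_dsum_prod_sum VU SU.
exists K, (prodm V S); split=> [//||i].
  exact: summand_trans UV (summand_prodl _ _).
rewrite leq_eqVlt => /predU1P[->|/CV CV'].
  exact: summand_trans CS (summand_prodr _ _).
exact: summand_trans CV' (summand_prodl _ _).
Qed.

Lemma Add_dsum (J : Type) U V X : is_dsum (fun _ : J => U) V -> Add V X -> Add
  U X.
Proof.
move=> VU [I [S [SV XS]]]; exists {_ : I & J}, S; split=> //.
by apply: (is_dsum_sigma (X := fun _ _ => U)) SV.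
Qed.

Lemma Add_of_summand U V X : summand U V -> Add U X -> Add V X.
Proof.
move=> /summandP[R VR] [I [S [SU XS]]].
have [T TR] := is_dsum_exists (fun _ : I => R).
have [W WV] := is_dsum_exists (fun _ : I => V).
exists I, W; split=> //; apply: summand_trans XS _; apply/summandP; exists T.
by apply: is_dsum_pairs SU TR _; apply: is_dsum_comp WV.
Qed.
End Coresolutions.

Theorem lemma3p4 (k : comPzRingType) (A : dgAlg k) (U : dgMod A) :
  coconnective A -> D_le0 U -> silting U ->
  exists U' : dgMod A, good_silting U' /\ silting_equiv U U'.
Proof.
move=> _ U0 [U_perp U_thick].
(* Both inclusions of Thick(U) = Thick(A) matter: U in Thick(A) makes maps out of U small and
   strict, A in Thick(U) gives the bounds. *)
have U_hproj : hproj_summand U.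
  have : Thick (regular A) U by apply/U_thick => P _; apply; apply: Add_self.
  by apply; [apply: thick_hproj_summand | apply: Add_regular_hproj].
have bA : perp_bound U (regular A).
  have : Thick U (regular A) by apply/U_thick => P _; apply; apply: Add_self.
  by apply; [apply: thick_perp_bound | apply: Add_perp_bound].
have [n /Add_cores_codim[Xs [Cs [Xs0 Xsn XsE]]]] := regular_Add_cores U_perp
  U_hproj U0 bA.
have [|J [V [VU UV CV]]] := @Add_common_dsum _ _ U Cs n.
  by move=> i /XsE[].
have UVE : silting_equiv U V.
  by move=> X; split; [apply: Add_of_summand UV | apply: Add_dsum VU].
exists V; split=> //; split; last first.
  exists n, Xs, Cs; split=> // i i_n; have [_ tri] := XsE i i_n.
  by split=> //; apply/fin_add_summand/CV.
(* Maps out of V are determined on the copies of U, and Thick(V) depends only on Add(V) = Add(U). *)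
split=> [X /UVE UX i i0|X].
  by apply: hz_dsum VU _ => _; apply: U_perp.
rewrite -U_thick; split=> H P tP VP; apply: H => // Y /UVE; apply: VP.
Qed.
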